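(* Let $A\in M_{m\times m}(\mathbb{C})$ and $B\in M_{n\times n}(\mathbb{C})$, and let $\varphi_{AB}$ be the linear operator on $M_{m\times n}(\mathbb{C})$ defined by $\varphi_{AB}(X)=AX-XB$. Let $\lambda_1,\dots,\lambda_a$ be the distinct eigenvalues of $A$ and $\mu_1,\dots,\mu_b$ the distinct eigenvalues of $B$. Let $\alpha_i=(\alpha_{i1},\dots,\alpha_{ip_i})=\omega(A,\lambda_i)$ be the Weyr characteristic of $A$ associated with $\lambda_i$ ($1\le i\le a$), and let $\beta_j=(\beta_{j1},\dots,\beta_{jq_j})=\omega(B,\mu_j)$ be the Weyr characteristic of $B$ associated with $\mu_j$ ($1\le j\le b$). Put $\alpha_{i,l}=0$ for $l>p_i$ and $\beta_{j,l}=0$ for $l>q_j$. Let $N_{\alpha_i}$, $N_{\beta_j}$ be the nilpotent Weyr matrices of Weyr characteristics $\alpha_i$, $\beta_j$, and write $\varphi_{\alpha_i\beta_j}$ for the operator $Y\mapsto N_{\alpha_i}Y-YN_{\beta_j}$. Write $\delta_{x,y}$ for the Kronecker delta. Then the following hold. (1) For each positive integer $k$, $$\dim\ker\varphi_{AB}^{k}=\sum_{i=1}^{a}\sum_{j=1}^{b}\delta_{\lambda_i,\mu_j}\dim\ker\varphi_{\alpha_i\beta_j}^{k}$$ $$=\sum_{i=1}^{a}\sum_{j=1}^{b}\delta_{\lambda_{i},\mu_{j}}\bigg(\sum_{r=2}^{k}\sum_{l=0}^{\min\{p_{i},q_{j}\}}\alpha_{i,r+l}(\beta_{j,1+l}-\beta_{j,2+k-r+l})+\sum_{l=0}^{\min\{p_{i},q_{j}\}}\alpha_{i,1+l}\sum_{s=1}^{k}\beta_{j,s+l}\bigg).$$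 (2) For each positive integer $k$, let $W_A$ and $W_B$ be the Weyr canonical forms of $A$ and $B$ (with blocks ordered as $\lambda_1,\dots,\lambda_a$ and $\mu_1,\dots,\mu_b$), and let $\alpha=(|\alpha_1|,\dots,|\alpha_a|)$, $\beta=(|\beta_1|,\dots,|\beta_b|)$, where $|\alpha_i|=\sum_{h}\alpha_{ih}$ and $|\beta_j|=\sum_h\beta_{jh}$. A basis of $\ker\varphi_{W_AW_B}^{k}$ is given by the matrices $$E_{ij}(\alpha,\beta)\boxtimes\left(\sum_{t=0}^{l}x_{kt}\,E_{r+t,s+t}(\alpha_{i},\beta_{j})\boxtimes Z_{r+l,s+l}(ij)\right),$$ where $(i,j)$ runs over all pairs with $1\le i\le a$, $1\le j\le b$, $\lambda_i=\mu_j$; for each such pair $(r,s,l)$ runs over all triples of integers such that either $s=1$, $2\le r\le\min\{p_i,k\}$, $0\le l\le\min\{p_i-r,q_j-1\}$, or $r=1$, $1\le s\le q_j$, $0\le l\le\min\{p_i-1,q_j-s\}$; for each such triple $Z_{r+l,s+l}(ij)$ runs over $\{e_{uv}\mid 1\le u\le\alpha_{i,r+l},\ \beta_{j,1+k-r+s+l}+1\le v\le\beta_{j,s+l}\}$; and $(x_{k0},x_{k1},\dots,x_{kl})$ is the solution of the formula $$\varphi_{p_iq_j}^{k-1}\Big(\sum_{t=0}^{l}x_{kt}\,e_{r+t,s+t}\Big)=\sum_{t=0}^{l}e_{1+t,k-r+s+t}+\sum_{t>l}y_t\,e_{1+t,k-r+s+t}\quad\text{for some scalars } y_t,$$ in which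 $\varphi_{p_iq_j}$ is the operator on $M_{p_i\times q_j}(\mathbb{C})$ given by $\varphi_{p_iq_j}(Y)=N_{p_i}Y-YN_{q_j}$, with $N_p=e_{12}+e_{23}+\cdots+e_{p-1,p}\in M_{p\times p}(\mathbb{C})$. (3) The set of eigenvalues of $\varphi_{AB}$ is $\{\lambda_i-\mu_j\mid 1\le i\le a,\ 1\le j\le b\}$. If $\omega=(\omega_1,\dots,\omega_q)$ is the Weyr characteristic of $\varphi_{AB}$ associated with an eigenvalue $\lambda$ of $\varphi_{AB}$, then $$\omega_{k}=\sum_{i=1}^{a}\sum_{j=1}^{b}\delta_{\lambda_{i}-\lambda,\mu_{j}}\sum_{l=0}^{\min\{p_{i},q_{j}\}}\bigg(\alpha_{i,1+l}\beta_{j,k+l}+\sum_{r=2}^{k}\alpha_{i,r+l}(\beta_{j,1+k-r+l}-\beta_{j,2+k-r+l})\bigg),$$ and the index $q$ of the eigenvalue $\lambda$ of $\varphi_{AB}$ equals $\max\{p_i+q_j-1\mid \lambda_i-\mu_j=\lambda\}$. (4) Consequently the operator $\varphi_{AB}$ is characterised within similarity by the numbers $\dim\ker\varphi_{A-\lambda I,B}^{k}$ for $1\le k\le mn$ and for each eigenvalue $\lambda=\lambda_i-\mu_j$ of $\varphi_{AB}$.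
   Context: Weyr characteristic: for a linear operator (or square matrix) $A$ on a finite-dimensional complex space and $\lambda\in\mathbb{C}$, put $\omega_k(A,\lambda)=\dim\ker(A-\lambda I)^k-\dim\ker(A-\lambda I)^{k-1}$ for $k\ge1$ (with $\dim\ker(A-\lambda I)^0=0$). The index of an eigenvalue $\lambda$ is the smallest positive integer $q$ with $\dim\ker(A-\lambda I)^q=\dim\ker(A-\lambda I)^{q+1}$. The Weyr characteristic of $A$ associated with an eigenvalue $\lambda$ of index $q$ is $\omega(A,\lambda)=(\omega_1(A,\lambda),\dots,\omega_q(A,\lambda))$, a nonincreasing sequence of positive integers. Nilpotent Weyr matrix: for a nonincreasing sequence of positive integers $\gamma=(\gamma_1,\dots,\gamma_p)$, $N_\gamma$ is the $p\times p$ block matrix whose $(i,j)$ block has size $\gamma_i\times\gamma_j$, whose $(i,i+1)$ block is $\begin{pmatrix}I_{\gamma_{i+1}}\\0\end{pmatrix}$ for $1\le i\le p-1$, and whose other blocks are zero. $I_\gamma$ is the identity matrix of size $|\gamma|=\sum_i\gamma_i$. Weyr canonical form: $W_A=(\lambda_1I_{\alpha_1}+N_{\alpha_1})\oplus\cdots\oplus(\lambda_aI_{\alpha_a}+N_{\alpha_a})$ and $W_B=(\mu_1I_{\beta_1}+N_{\beta_1})\oplus\cdots\oplus(\mu_bI_{\beta_b}+N_{\beta_b})$; these are similar to $A$ and $B$ respectively. Notation $\varphi_{CD}$: for square matrices $C,D$, $\varphi_{CD}(X)=CX-XD$; powers are compositions, the zeroth power being the identity. Block notation: $e_{uv}$ is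 the matrix unit (of the appropriate size) with a single $1$ in position $(u,v)$; it is read as $0$ when $(u,v)$ lies outside the range of the matrix. For finite sequences of positive integers $\gamma=(\gamma_1,\dots,\gamma_p)$ and $\delta=(\delta_1,\dots,\delta_q)$, a block matrix of type $(\gamma,\delta)$ is a $p\times q$ block matrix whose $(i,j)$ block has size $\gamma_i\times\delta_j$. For a $k'\times l'$ matrix $Z$, $E_{ij}(\gamma,\delta)\boxtimes Z$ is the block matrix of type $(\gamma,\delta)$ all of whose blocks are zero except the $(i,j)$ block, which is the $\gamma_i\times\delta_j$ matrix whose upper left $\min\{\gamma_i,k'\}\times\min\{\delta_j,l'\}$ corner agrees with that of $Z$ and whose other entries are zero. ''Characterised within similarity'' means: for $C\in M_{m\times m}(\mathbb{C})$ and $D\in M_{n\times n}(\mathbb{C})$, $\varphi_{AB}$ is similar to $\varphi_{CD}$ if and only if $\dim\ker\varphi_{A-\lambda I,B}^{k}=\dim\ker\varphi_{C-\lambda I,D}^{k}$ for each eigenvalue $\lambda$ of $\varphi_{AB}$ and all these $k$. Two linear operators $\varphi,\psi$ on a vector space are similar if $\psi=\theta^{-1}\varphi\theta$ for some invertible linear operator $\theta$.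
   Formalization: In (2), when k−r+s+l > q_j the formula does not determine (x_k0,…,x_kl) uniquely (x = 0 may solve it); there ''the solution'' means any solution with x_kl ≠ 0, which exists, and every such choice gives a basis. *)

(* Defs.v *)
From HB Require Import structures.
From mathcomp Require Import all_boot all_order all_algebra.
From mathcomp Require Import reals complex.

Set Implicit Arguments.
Unset Strict Implicit.
Unset Printing Implicit Defensive.
Import GRing.Theory.
Local Open Scope ring_scope.

Section Operators.
Variables (F : fieldType) (V : vectType F).
Implicit Types (f g : 'End(V)) (z : F).

(* 'End(V) is a ring in MathComp only when V is known to be nonzero, hence an
   explicit compositional power. *)
Definition lpow f (k : nat) : 'End(V) := iter k (fun g => (f \o g)%VF) \1%VF.

Definition kerdim f z (k : nat) : nat := \dim (lker (lpow (f - z *: \1%VF) k)).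

Lemma kerdim_leS f z k : (kerdim f z k <= kerdim f z k.+1)%N.
Proof.
apply/dimvS/subvP => v; rewrite !memv_ker /= comp_lfunE => /eqP ->.
by rewrite linear0.
Qed.

Lemma kerdim_stationary f z :
  exists q, (0 < q)%N && (kerdim f z q == kerdim f z q.+1).
Proof.
pose P (q : nat) := (0 < q)%N && (kerdim f z q == kerdim f z q.+1).
set d := \dim {:V}.
case: (boolP (has P (iota 1 d.+1))) => [/hasP[q _ Pq]|/hasPn H]; first by exists q.
suff K k : (k <= d.+1)%N -> (k <= kerdim f z k.+1)%N.
  by have := leq_trans (K d.+1 (leqnn _)) (dimvS (subvf _)); rewrite ltnn.
elim: k => // k IHk kd; apply: leq_ltn_trans (IHk (ltnW kd)) _.
rewrite ltn_neqAle kerdim_leS andbT.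
by have := H k.+1; rewrite mem_iota /P /= add1n ltnS => /(_ kd).
Qed.

(* Truncated subtraction is harmless here by kerdim_leS. *)
Definition weyr_num f z (k : nat) : nat := (kerdim f z k - kerdim f z k.-1)%N.

Definition op_index f z : nat := ex_minn (kerdim_stationary f z).

Definition weyr_char f z : seq nat :=
  mkseq (fun h => weyr_num f z h.+1) (op_index f z).

Definition op_similar f g : Prop :=
  exists th thi : 'End(V),
    [/\ (th \o thi)%VF = \1%VF, (thi \o th)%VF = \1%VF
      & g = (thi \o f \o th)%VF].

End Operators.

Section Matrices.
Variable F : fieldType.

Definition mxop m (A : 'M[F]_m) : 'End('cV[F]_m) := linfun (mulmx A).

Definition sylv m n (A : 'M[F]_m) (B : 'M[F]_n) : 'End('M[F]_(m, n)) :=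
  linfun (fun X : 'M[F]_(m, n) => A *m X - X *m B).

Lemma sylvE m n (A : 'M[F]_m) (B : 'M[F]_n) X :
  sylv A B X = A *m X - X *m B.
Proof.
have lin : linear (fun Y : 'M[F]_(m, n) => A *m Y - Y *m B).
  by move=> c Y Z; rewrite mulmxDr mulmxDl -scalemxAr -scalemxAl scalerBr opprD addrACA.
pose lT := GRing.isLinear.Build _ _ _ _ _ lin.
pose g : {linear _ -> _} := HB.pack (fun Y : 'M[F]_(m, n) => A *m Y - Y *m B) lT.
exact: (lfunE g).
Qed.

(* The l-th term (l >= 1) of a finite sequence, extended by zeros. *)
Definition term (s : seq nat) (l : nat) : nat := nth 0%N s l.-1.

Definition block_size (s : seq nat) (h : 'I_(size s)) : nat := nth 0%N s h.

Definition weight (s : seq nat) : nat := (\sum_h block_size (s := s) h)%N.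

(* For nonincreasing s, pid_mx is the block with the identity of size s_(j)
   on top of zero rows. *)
Definition nilp_weyr (s : seq nat) : 'M[F]_(weight s) :=
  \mxblock_(i < size s, j < size s)
    (if j == i.+1 :> nat then pid_mx (block_size j)
     else 0 : 'M[F]_(block_size i, block_size j)).

Definition weyr_form a (lam : 'I_a -> F) (alpha : 'I_a -> seq nat) :
    'M[F]_(\sum_i weight (alpha i)) :=
  \mxdiag_(i < a) ((lam i)%:M + nilp_weyr (alpha i)).

(* Matrix units and block positions are numbered from 1; a position outside
   the matrix gives 0. *)
Definition eunit p q (u v : nat) : 'M[F]_(p, q) :=
  \matrix_(x, y) ((x.+1 == u) && (y.+1 == v))%:R.

Definition corner p q p' q' (Z : 'M[F]_(p', q')) : 'M[F]_(p, q) :=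
  \matrix_(x, y) match insub (x : nat), insub (y : nat) with
                 | Some x', Some y' => Z x' y'
                 | _, _ => 0
                 end.

Definition Ebox p q (gamma : 'I_p -> nat) (delta : 'I_q -> nat) (i j : nat)
    p' q' (Z : 'M[F]_(p', q')) : 'M[F]_(\sum_x gamma x, \sum_y delta y) :=
  \mxblock_(x < p, y < q)
    (if (x.+1 == i) && (y.+1 == j) then corner _ _ Z
     else 0 : 'M[F]_(gamma x, delta y)).

Definition nilp_jordan p : 'M[F]_p := \sum_(1 <= h < p) eunit p p h h.+1.

Definition chain_eq p q (k r s l : nat) (x : nat -> F) : Prop :=
  exists y : nat -> F,
    lpow (sylv (nilp_jordan p) (nilp_jordan q)) k.-1
      (\sum_(0 <= t < l.+1) x t *: eunit p q (r + t) (s + t))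
    = \sum_(0 <= t < l.+1) eunit p q (1 + t) (k - r + s + t)
      + \sum_(l.+1 <= t < p) y t *: eunit p q (1 + t) (k - r + s + t).

(* When k - r + s + l <= q, chain_eq determines x 0, ..., x l.  Otherwise some
   units eunit p q (1 + t) (k - r + s + t) with t <= l vanish and chain_eq is
   underdetermined; degenerate solutions (such as x = 0 when k - r + s > q)
   do not yield a basis, so a nonzero last coefficient is required there. *)
Definition chain_sol p q (k r s l : nat) (x : nat -> F) : Prop :=
  chain_eq p q k r s l x /\ ((q < k - r + s + l)%N -> x l != 0).

Definition triples (p q k : nat) : seq (nat * nat * nat) :=
  [seq (r, 1%N, l) | r <- iota 2 (minn p k - 1), l <- iota 0 (minn (p - r) (q - 1)).+1]
  ++ [seq (1%N, s, l) | s <- iota 1 q, l <- iota 0 (minn (p - 1) (q - s)).+1].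

(* u ranges over 1 .. al_(r+l) and v over be_(1+k-r+s+l)+1 .. be_(s+l). *)
Definition unit_positions (al be : seq nat) (k r s l : nat) : seq (nat * nat) :=
  [seq (u, v) | u <- iota 1 (term al (r + l)),
                v <- iota (term be (1 + k - r + s + l)).+1
                       (term be (s + l) - term be (1 + k - r + s + l))].

Definition ker_basis_mx a b (alpha : 'I_a -> seq nat) (beta : 'I_b -> seq nat)
    (i : 'I_a) (j : 'I_b) (r s l : nat) (x : nat -> F) (u v : nat) :
    'M[F]_(\sum_i weight (alpha i), \sum_j weight (beta j)) :=
  Ebox (fun i => weight (alpha i)) (fun j => weight (beta j)) i.+1 j.+1
    (\sum_(0 <= t < l.+1)
       x t *: Ebox (@block_size (alpha i)) (@block_size (beta j)) (r + t) (s + t)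
                (eunit (term (alpha i) (r + l)) (term (beta j) (s + l)) u v)).

(* x i j r s l t is the coefficient x_(kt) attached to (i, j) and (r, s, l). *)
Definition ker_basis a b (lam : 'I_a -> F) (mu : 'I_b -> F)
    (alpha : 'I_a -> seq nat) (beta : 'I_b -> seq nat) (k : nat)
    (x : 'I_a -> 'I_b -> nat -> nat -> nat -> nat -> F) :
    seq 'M[F]_(\sum_i weight (alpha i), \sum_j weight (beta j)) :=
  flatten
    [seq [seq let: (r, s, l) := w in
              ker_basis_mx alpha beta ij.1 ij.2 r s l (x ij.1 ij.2 r s l) uv.1 uv.2
         | w <- triples (size (alpha ij.1)) (size (beta ij.2)) k,
           uv <- let: (r, s, l) := w in
                 unit_positions (alpha ij.1) (beta ij.2) k r s l]
    | ij <- enum [pred ij : 'I_a * 'I_b | lam ij.1 == mu ij.2]].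

End Matrices.

(* Main.v *)
Require Import Defs.
From HB Require Import structures.
From mathcomp Require Import all_boot all_order all_algebra.
From mathcomp Require Import reals complex.
From mathcomp Require Import zify ring.

(** The theorem reduces to a statement about coefficients of (1 - X)^k f.

A row of the Weyr form W_A is located by a triple (i, h, u): the eigenvalue
lam i, the level h (a block of N_(alpha i)) and the rank u inside the block.
The nilpotent part moves the level and keeps the rank.  Hence
Y |-> W_A Y - Y W_B acts separately on the entries with given eigenvalues
(i, j) and given ranks (u, v), a rectangle indexed by the levels (h, h').  If
lam i <> mu j it is invertible there.  If lam i = mu j it sends the entry at
(h, h') to (h - 1, h') and, with the opposite sign, to (h, h' + 1); both
positions lie on the same diagonal.  When the entries of a diagonal starting on
the upper or left border are stored in a polynomial f, the k-th power of the
operator stores (1 - X)^k f, except that the coefficients pushed out of the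
rectangle are lost ([entry_sylv_pow]).  So X lies in the kernel of the k-th
power if and only if, on each border diagonal, a window of consecutive
coefficients of (1 - X)^k f vanishes.

The decisive fact is [window_eq0]: in characteristic 0, if f has at most M
coefficients and M consecutive coefficients of (1 - X)^N f vanish, starting at
some d <= N, then f = 0.  In other words the Toeplitz matrices of binomial
coefficients are invertible.  It gives the existence and the uniqueness of the
chain coefficients x_(k0), ..., x_(kl), whose polynomial f is characterised by
a window of ones in (1 - X)^(k-1) f, and it gives x_(kl) <> 0.  It also shows
that a matrix of the kernel is determined by its entries at the last positions
(r + l, s + l) of the chains.  Since the chains are triangular for these entries
([triangular_basis]), they form a basis of the kernel ([label_basis]), which is
the second assertion for the Weyr forms.

Counting the basis gives the dimension formula ([ker_countE]); consecutive
differences give the Weyr characteristic, and the sign of these differences the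
index ([ker_count_ltS]).

There remains the similarity of A and W_A, by the usual construction: complements
of ker g^h in ker g^(h+1) are chosen from the top level down, each containing the
image of the previous one ([jordan_levels]); the generalised eigenspaces are
independent because powers of distinct linear factors are coprime
([gen_eigenspaces_direct]) and fill the space by Cayley-Hamilton
([weights_full]).  The resulting isomorphism ([weyr_iso]) is built for an
operator on any space, from a hypothesis on kernel dimensions alone; so two
operators with the same kernel dimensions are similar ([op_similar_kerdim]), which
is the last assertion.
*)

Set Implicit Arguments.
Unset Strict Implicit.
Unset Printing Implicit Defensive.
Import Order.TTheory GRing.Theory Num.Theory.
Local Open Scope ring_scope.

(** * Windows of coefficients of multiples of a power of 1 - X *)

Section Window.
Variable F : numFieldType.
Implicit Types (f q : {poly F}) (N d M : nat).

Lemma dvdp_exp_deriv q f N : q ^+ N.+1 %| f -> q ^+ N %| f^`().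
Proof.
move=> /dvdpP[a ->]; rewrite derivM deriv_exp /= dvdp_addl.
  by rewrite exprS mulrA dvdp_mulIr.
by rewrite -mulrnAl mulrA dvdp_mulIr.
Qed.

Lemma dvdp_exp_derivn q f N n : q ^+ (n + N) %| f -> q ^+ N %| f^`(n).
Proof.
elim: n N => [|n IHn] N; first by rewrite derivn0.
by rewrite derivnS addSnnS => /IHn/dvdp_exp_deriv.
Qed.

Lemma sizeN1X : size (1 - 'X : {poly F}) = 2%N.
Proof. by rewrite -[1 - _]opprB size_polyN size_XsubC. Qed.

Lemma N1X_neq0 : (1 - 'X : {poly F}) != 0.
Proof. by rewrite -size_poly_gt0 sizeN1X. Qed.

Lemma size_N1X_exp N : size ((1 - 'X : {poly F}) ^+ N) = N.+1.
Proof.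
have := size_exp (1 - 'X : {poly F}) N; rewrite sizeN1X mul1n => e.
by rewrite -[N in RHS]e prednK // size_poly_gt0 expf_neq0 ?N1X_neq0.
Qed.

(** The d-th derivative of g = (1 - X)^N f forgets the coefficients of g below d,
    and the next M ones vanish: it equals 'X^M * h with h of size at most N - d.
    It is a multiple of (1 - X)^(N - d), hence so is h, and h = 0.  Then g has
    size at most d <= N, too small for a nonzero multiple of (1 - X)^N.
    Characteristic 0 keeps the falling factorials nonzero. *)
Lemma window_eq0 N d M f : (d <= N)%N -> (size f <= M)%N ->
  (forall t, (t < M)%N -> ((1 - 'X) ^+ N * f)`_(d + t) = 0) -> f = 0.
Proof.
move=> dN szf; set g := (1 - 'X) ^+ N * f => g0.
apply/eqP; apply: contraTT isT => fn0; exfalso.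
have szg : size g = (N + size f)%N.
  by rewrite size_mul ?expf_neq0 ?N1X_neq0 // size_N1X_exp.
(* The part of the d-th derivative beyond the window. *)
pose h := \poly_(i < N - d) (g`_(d + M + i) *+ (d + M + i) ^_ d).
have dg : g^`(d) = 'X^M * h.
  apply/polyP => i; rewrite coef_derivn coefXnM coef_poly.
  case: ltnP => iM; first by rewrite g0 ?mul0rn.
  have -> : (d + M + (i - M) = d + i)%N by lia.
  case: ltnP => // iN; rewrite nth_default ?mul0rn //.
  by rewrite szg; lia.
have h0 : h = 0.
  have : (1 - 'X) ^+ (N - d) %| h.
    rewrite -(@Gauss_dvdpr _ h 'X^M); last first.
      rewrite coprimep_expl // coprimep_expr // coprimepX rootE.
      by rewrite !hornerE subr0 oner_eq0.
    by rewrite -dg; apply: dvdp_exp_derivn; rewrite subnKC // dvdp_mulIl.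
  apply: contraTeq => hn0; apply/negP => /(dvdp_leq hn0).
  rewrite size_N1X_exp leqNgt => /negP; apply; exact: (leq_ltn_trans (size_poly _ _)).
have szf0 : (0 < size f)%N by rewrite size_poly_gt0.
have : g`_(size g).-1 == 0.
  case: (ltnP (size g).-1 (d + M)) => le; last first.
    have := congr1 (fun r : {poly F} => r`_((size g).-1 - (d + M))) h0.
    rewrite coef_poly coef0 ifT; last by rewrite szg in le *; lia.
    move/eqP; rewrite subnKC // mulrn_eq0 => /orP[|//].
    by rewrite -leqn0 leqNgt ffact_gt0; move: le; lia.
  rewrite -(subnKC (_ : d <= (size g).-1)%N) ?g0 //; first by move: le; lia.
  by rewrite szg; lia.
by rewrite -lead_coefE lead_coef_eq0 (negPf (mulf_neq0 (expf_neq0 _ N1X_neq0) fn0)).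
Qed.

(** A Toeplitz matrix of signed binomial coefficients of N. *)
Definition window_mx N d M : 'M[F]_M :=
  \matrix_(i, t) ((1 - 'X) ^+ N * 'X^i)`_(d + t).

Lemma mul_window_mx N d M (z : 'rV[F]_M) :
  z *m window_mx N d M = \row_t ((1 - 'X) ^+ N * rVpoly z)`_(d + t).
Proof.
apply/rowP => t; rewrite !mxE {2}[z]row_sum_delta linear_sum mulr_sumr coef_sum.
by apply: eq_bigr => i _; rewrite linearZ /= rVpoly_delta -scalerAr coefZ mxE.
Qed.

Lemma window_mx_unit N d M : (d <= N)%N -> window_mx N d M \in unitmx.
Proof.
move=> dN; rewrite -row_free_unit -kermx_eq0; apply/eqP/row_matrixP => i; rewrite row0.
apply: (can_inj rVpolyK); rewrite linear0.
apply: (window_eq0 dN (size_poly _ _)) => t tM.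
have : row i (kermx (window_mx N d M)) *m window_mx N d M = 0.
  by rewrite -row_mul mulmx_ker row0.
by rewrite mul_window_mx => /rowP /(_ (Ordinal tM)); rewrite !mxE.
Qed.

Definition window_sol N d M : {poly F} :=
  rVpoly (const_mx 1 *m invmx (window_mx N d M)).

Lemma size_window_sol N d M : (size (window_sol N d M) <= M)%N.
Proof. exact: size_poly. Qed.

Lemma window_solP N d M t : (d <= N)%N -> (t < M)%N ->
  ((1 - 'X) ^+ N * window_sol N d M)`_(d + t) = 1.
Proof.
move=> dN tM; have := mul_window_mx N d (const_mx 1 *m invmx (window_mx N d M)).
rewrite mulmxKV ?window_mx_unit // => /rowP /(_ (Ordinal tM)).
by rewrite !mxE.
Qed.

Lemma coef_N1XM f e : ((1 - 'X) * f)`_e = f`_e - (if e is e'.+1 then f`_e' else 0).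
Proof. by rewrite mulrBl mul1r coefB coefXM; case: e. Qed.

(** If this coefficient vanished, f would have at most l of them; one more factor
    1 - X would turn the constant window into a window of l zeros starting at d.+1, and
    [window_eq0] for the exponent N.+1 would give f = 0. *)
Lemma window_last_neq0 N d l f : (d <= N)%N -> (size f <= l.+1)%N ->
  (forall t, (t <= l)%N -> ((1 - 'X) ^+ N * f)`_(d + t) = 1) -> f`_l != 0.
Proof.
move=> dN szf f1; apply: contraTneq isT => fl0; exfalso.
have szfl : (size f <= l)%N.
  apply/leq_sizeP => j; rewrite leq_eqVlt => /orP[/eqP<- //|lj].
  by rewrite nth_default // (leq_trans szf).
have : f = 0.
  apply: (@window_eq0 N.+1 d.+1 l) => // t tl.
  rewrite exprS -mulrA coef_N1XM addSnnS f1 // addnS f1 ?subrr //; exact: ltnW.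
move=> f0; have := f1 0 (leq0n _); rewrite f0 mulr0 coef0 => /esym/eqP.
by rewrite oner_eq0.
Qed.

End Window.
Arguments window_sol : clear implicits.

(** * Bases detected by a triangular family of functionals *)

Section Triangular.
Variables (F : fieldType) (V : vectType F) (W : eqType).
Variables (b : W -> V) (phi : W -> {scalar V}) (rho : W -> nat).

(** Once the labels are sorted by decreasing [rho], the functional of each label
    vanishes on the vectors of all later ones. *)
Lemma triangular_free (ws : seq W) : uniq ws ->
  {in ws, forall w, phi w (b w) != 0} ->
  {in ws &, forall w w', w' != w -> (rho w' <= rho w)%N -> phi w (b w') = 0} ->
  free (map b ws).
Proof.
pose le : rel W := fun w w' => (rho w' <= rho w)%N.
move=> uws nz tri; rewrite -(perm_free (perm_map b (permEl (perm_sort le ws)))).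
have: sorted le (sort le ws) by apply: sort_sorted => w w'; apply: leq_total.
have: {subset sort le ws <= ws} by move=> w; rewrite mem_sort.
have: uniq (sort le ws) by rewrite sort_uniq.
elim: (sort le ws) => [|w s IHs] /=; first by rewrite nil_free.
move=> /andP[ws' us] sub srt.
have tr : transitive le by move=> x y z h1 h2; apply: leq_trans h2 h1.
rewrite free_cons IHs ?(path_sorted srt) // => [|x xs]; last first.
  by apply: sub; rewrite inE xs orbT.
rewrite andbT; apply/negP => bw.
have wws : w \in ws by apply: sub; rewrite inE eqxx.
suff : phi w (b w) == 0 by rewrite (negPf (nz _ wws)).
have vanish v : v \in <<map b s>>%VS -> phi w v = 0.
  move=> /(@coord_span _ _ _ (in_tuple _)) ->; rewrite linear_sum big1 // => i _.
  rewrite linearZ /=; have ilt : (i < size s)%N by rewrite -(size_map b).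
  rewrite (nth_map w) //; have xs := mem_nth w ilt.
  rewrite tri ?mulr0 //.
  - by apply: sub; rewrite inE xs orbT.
  - by apply: contraNneq ws' => <-.
  - by have /allP /(_ _ xs) := order_path_min tr srt.
by rewrite vanish.
Qed.

Lemma dim_functionals (ws : seq W) (K : {vspace V}) :
  (forall v, v \in K -> {in ws, forall w, phi w v = 0} -> v = 0) ->
  (\dim K <= size ws)%N.
Proof.
move=> inj.
pose g v : 'rV[F]_(size ws) := \row_(i < size ws) phi (tnth (in_tuple ws) i) v.
have ling : linear g by move=> c u v; apply/rowP => i; rewrite !mxE linearP.
pose lT := GRing.isLinear.Build _ _ _ _ _ ling.
pose gl : {linear _ -> _} := HB.pack g lT.
have K0 : (K :&: lker (linfun gl) = 0)%VS.
  apply/eqP; rewrite -subv0; apply/subvP => v; rewrite memv_cap memv_ker lfunE /=.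
  case/andP => vK /eqP gv0; rewrite memv0; apply/eqP/inj => // w wws.
  have iP : (index w ws < size ws)%N by rewrite index_mem.
  have := congr1 (fun r : 'rV_(size ws) => r 0 (Ordinal iP)) gv0.
  by rewrite !mxE (tnth_nth w) /= nth_index.
rewrite -(limg_dim_eq K0); apply: (leq_trans (dimvS (subvf _))).
by rewrite dimvf /dim /= mul1n.
Qed.

(** The functionals are used twice: triangularity makes the family free, and joint
    injectivity on K bounds the dimension of K by the number of labels. *)
Lemma triangular_basis (ws : seq W) (K : {vspace V}) : uniq ws ->
  {in ws, forall w, b w \in K} ->
  {in ws, forall w, phi w (b w) != 0} ->
  {in ws &, forall w w', w' != w -> (rho w' <= rho w)%N -> phi w (b w') = 0} ->
  (forall v, v \in K -> {in ws, forall w, phi w v = 0} -> v = 0) ->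
  basis_of K (map b ws).
Proof.
move=> uws bK nz tri inj; rewrite basisEfree triangular_free //= size_map.
rewrite dim_functionals // andbT; apply/span_subvP => v /mapP[w wws ->].
exact: bK.
Qed.

End Triangular.

(** * Weyr matrices in coordinates and the diagonals of a matrix *)

Definition nonincr (s : seq nat) := forall h, (nth 0%N s h.+1 <= nth 0%N s h)%N.

Lemma nonincr_le s h h' : nonincr s -> (h <= h')%N -> (nth 0%N s h' <= nth 0%N s h)%N.
Proof.
move=> ns; elim: h' => [|h' IH]; first by rewrite leqn0 => /eqP->.
by rewrite leq_eqVlt => /orP[/eqP-> //|/IH]; apply: leq_trans.
Qed.

(** The number Q of levels having a rank v is an entry of the conjugate partition
    of s. *)
Lemma nonincr_height s v : nonincr s ->
  exists2 Q, (Q <= size s)%N & forall h, (v < nth 0%N s h)%N = (h < Q)%N.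
Proof.
move=> ns; exists (find (fun y => (y <= v)%N) s); first exact: find_size.
move=> h; case: (ltnP h (find _ s)) => hQ.
  by have := before_find 0%N hQ; rewrite ltnNge => ->.
apply/negbTE; rewrite -leqNgt.
case: (ltnP (find (fun y => (y <= v)%N) s) (size s)) => [lt|ge].
  by apply: leq_trans (nonincr_le ns hQ) _;
    apply: (nth_find 0%N (a := fun y => (y <= v)%N)); rewrite has_find.
by rewrite nth_default // (leq_trans ge).
Qed.

Section Coords.
Variables (F : fieldType) (a : nat) (lam : 'I_a -> F) (alpha : 'I_a -> seq nat).
Variables (M : nat) (pos : 'I_M -> 'I_a * nat * nat).

Implicit Types (i j : 'I_a) (h u v : nat) (p : 'I_a * nat * nat).

Definition valid_pos (p : 'I_a * nat * nat) := (p.2 < nth 0%N (alpha p.1.1) p.1.2)%N.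

(** The map [pos] numbers the rows by eigenvalue, level and rank, all counted
    from 0.  Keeping it abstract lets a single development cover the Weyr form,
    the blocks N_gamma and the Jordan blocks N_p. *)
Definition weyr_coords := injective pos /\ forall p, (exists x, pos x = p) <-> valid_pos p.

Definition weyr_mx : 'M[F]_M :=
  \matrix_(x, y) ((x == y)%:R * lam (pos x).1.1
                  + (pos y == ((pos x).1.1, (pos x).1.2.+1, (pos x).2))%:R).

(** A unit row vector, or 0 if the position lies outside the matrix, so that shifts
    of positions need no side condition. *)
Definition pos_row p : 'rV[F]_M := \row_x (pos x == p)%:R.

Hypothesis posP : weyr_coords.
Hypothesis alphaP : forall i, nonincr (alpha i).

Lemma pos_row_pos x : pos_row (pos x) = delta_mx 0 x.
Proof. by apply/rowP => y; rewrite !mxE (inj_eq (proj1 posP)). Qed.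

Lemma pos_row_invalid p : ~~ valid_pos p -> pos_row p = 0.
Proof.
move=> vp; apply/rowP => y; rewrite !mxE; case: eqP => // yp.
by move/negP: vp; case; apply/(proj2 posP); exists y.
Qed.

Lemma valid_down i h h' u : (h <= h')%N -> valid_pos (i, h', u) -> valid_pos (i, h, u).
Proof. by move=> hh vp; apply: leq_trans vp (nonincr_le _ _). Qed.

Lemma pos_row_mul i h u :
  pos_row (i, h, u) *m weyr_mx = lam i *: pos_row (i, h, u) + pos_row (i, h.+1, u).
Proof.
case: (boolP (valid_pos (i, h, u))) => vp; last first.
  rewrite !pos_row_invalid ?mul0mx ?scaler0 ?addr0 //.
  by apply: contra vp; apply: valid_down.
have /(proj2 posP) [x px] := vp.
rewrite -px pos_row_pos -rowE; apply/rowP => y; rewrite !mxE px /=.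
by rewrite mulrC eq_sym.
Qed.

Lemma mul_pos_col j h v : valid_pos (j, h, v) ->
  weyr_mx *m (pos_row (j, h, v))^T =
  lam j *: (pos_row (j, h, v))^T + (if h is h'.+1 then (pos_row (j, h', v))^T else 0).
Proof.
move=> /(proj2 posP) [y py].
rewrite -py pos_row_pos trmx_delta -colE; apply/colP => x; rewrite !mxE py /=.
congr (_ + _).
  by rewrite andbT mulrC; case: eqP => [->|]; rewrite ?py // !mulr0.
case: h py => [|h'] py; rewrite !mxE.
  by case: eqP.
by case: (pos x) => [[i h] u] /=; congr (_%:R); rewrite !xpair_eqE eqSS [j == i]eq_sym
  [h' == h]eq_sym [v == u]eq_sym.
Qed.

Lemma pos_row_tr p p' : pos_row p *m (pos_row p')^T = ((p == p') && valid_pos p)%:R%:M.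
Proof.
apply/matrixP => i j; rewrite !mxE !ord1 eqxx mulr1n.
case: (boolP (valid_pos p)) => vp; last first.
  by rewrite andbF big1 // => x _; rewrite pos_row_invalid // mxE mul0r.
have /(proj2 posP) [x px] := vp.
rewrite andbT (bigD1 x) //= !mxE -px eqxx mul1r big1 ?addr0 // => y yx.
by rewrite !mxE (inj_eq (proj1 posP)) (negPf yx) mul0r.
Qed.

End Coords.

Section Kernel.
Variables (F : numFieldType) (a b : nat) (lam : 'I_a -> F) (mu : 'I_b -> F).
Variables (alpha : 'I_a -> seq nat) (beta : 'I_b -> seq nat).
Variables (M N : nat) (posA : 'I_M -> 'I_a * nat * nat) (posB : 'I_N -> 'I_b * nat * nat).
Hypotheses (posAP : weyr_coords alpha posA) (posBP : weyr_coords beta posB).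
Hypotheses (alphaP : forall i, nonincr (alpha i)) (betaP : forall j, nonincr (beta j)).

Implicit Types (i : 'I_a) (j : 'I_b) (h u v r s e k : nat).
Implicit Types (p : 'I_a * nat * nat) (q : 'I_b * nat * nat) (X : 'M[F]_(M, N)).

Definition entry p q X : F :=
  (pos_row F posA p *m X *m (pos_row F posB q)^T) 0 0.

Lemma entry_linear p q : scalar (entry p q).
Proof.
by move=> c X Y; rewrite /entry mulmxDr mulmxDl -scalemxAr -scalemxAl !mxE.
Qed.
HB.instance Definition _ p q := GRing.isLinear.Build _ _ _ _ (entry p q) (@entry_linear p q).

Lemma entryE X x y : entry (posA x) (posB y) X = X x y.
Proof.
by rewrite /entry (pos_row_pos _ posAP) (pos_row_pos _ posBP) trmx_delta -rowE -colE !mxE.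
Qed.

Lemma entry_inj X : (forall p q, entry p q X = 0) -> X = 0.
Proof. by move=> X0; apply/matrixP => x y; rewrite mxE -entryE X0. Qed.

Lemma entry_invalidl p q X : ~~ valid_pos alpha p -> entry p q X = 0.
Proof. by move=> vp; rewrite /entry (pos_row_invalid _ posAP vp) !mul0mx mxE. Qed.

Lemma entry_invalidr p q X : ~~ valid_pos beta q -> entry p q X = 0.
Proof. by move=> vp; rewrite /entry (pos_row_invalid _ posBP vp) trmx0 mulmx0 mxE. Qed.

Let phiAB := sylv (weyr_mx lam posA) (weyr_mx mu posB).

(** The ranks u and v and the eigenvalues i and j are left unchanged, so the
    operator splits along them. *)
Lemma entry_sylv i h u j h' v X : valid_pos beta (j, h', v) ->
  entry (i, h, u) (j, h', v) (phiAB X) =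
  (lam i - mu j) * entry (i, h, u) (j, h', v) X + entry (i, h.+1, u) (j, h', v) X
  - (if h' is h''.+1 then entry (i, h, u) (j, h'', v) X else 0).
Proof.
move=> vq; rewrite /entry /phiAB sylvE mulmxBr mulmxBl mulmxA (pos_row_mul _ posAP alphaP).
rewrite [X in _ - X](_ : _ = pos_row F posA (i, h, u) *m X
                               *m (weyr_mx mu posB *m (pos_row F posB (j, h', v))^T)); last first.
  by rewrite !mulmxA.
rewrite (mul_pos_col _ posBP vq) !mulmxDl mulmxDr -!scalemxAl -scalemxAr.
pose E (Z : 'M[F]_1) : F := Z 0 0.
have ED Y Z : E (Y + Z) = E Y + E Z by rewrite /E mxE.
have EZ c Z : E (c *: Z) = c * E Z by rewrite /E mxE.
have EN Z : E (- Z) = - E Z by rewrite /E mxE.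
rewrite -!/(E _) !(ED, EN, EZ).
case: h' {vq} => [|h'']; first by rewrite mulmx0 [E 0]mxE; ring.
rewrite -!/(E _).
by ring.
Qed.

Lemma entry_sylv_pow_block i j k X :
  (forall h u h' v : nat, entry (i, h, u) (j, h', v) X = 0) ->
  forall h u h' v : nat, entry (i, h, u) (j, h', v) (lpow phiAB k X) = 0.
Proof.
move=> X0; elim: k => [|k IHk] h u h' v; first by rewrite id_lfunE.
case: (boolP (valid_pos beta (j, h', v))) => vq; last exact: entry_invalidr.
rewrite /= comp_lfunE entry_sylv // !IHk mulr0 addr0 sub0r.
by case: h' {vq} => [|h'']; rewrite ?IHk ?oppr0.
Qed.

(** The recurrence [entry_sylv] can be solved for the entry at (h, h'), because its
    coefficient is nonzero; the other two entries come earlier when h' increases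
    from 0 and h decreases from the last level. *)
Lemma entry_sylv_neq0 i j X : lam i != mu j ->
  (forall h u h' v : nat, entry (i, h, u) (j, h', v) (phiAB X) = 0) ->
  forall h u h' v : nat, entry (i, h, u) (j, h', v) X = 0.
Proof.
move=> ne SX0 h u h' v; elim: h' h => [|h' IH'] h.
  have [n] := ubnP (size (alpha i) - h)%N; elim: n h => // n IHn h hn.
  case: (boolP (valid_pos beta (j, 0, v))) => vq; last exact: entry_invalidr.
  have := SX0 h u 0 v; rewrite entry_sylv // subr0.
  case: (ltnP h (size (alpha i))) => hs; last first.
    by rewrite entry_invalidl // /valid_pos /= nth_default // -leqNgt.
  rewrite (IHn h.+1); last by lia.
  by rewrite addr0 => /eqP; rewrite mulf_eq0 subr_eq0 (negPf ne) => /eqP.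
have [n] := ubnP (size (alpha i) - h)%N; elim: n h => // n IHn h hn.
case: (boolP (valid_pos beta (j, h'.+1, v))) => vq; last exact: entry_invalidr.
have := SX0 h u h'.+1 v; rewrite entry_sylv // IH' subr0.
case: (ltnP h (size (alpha i))) => hs; last first.
  by rewrite entry_invalidl // /valid_pos /= nth_default // -leqNgt.
rewrite (IHn h.+1); last by lia.
by rewrite addr0 => /eqP; rewrite mulf_eq0 subr_eq0 (negPf ne) => /eqP.
Qed.

Lemma entry_sylv_pow_neq0 i j k X : lam i != mu j ->
  (forall h u h' v : nat, entry (i, h, u) (j, h', v) (lpow phiAB k X) = 0) ->
  forall h u h' v : nat, entry (i, h, u) (j, h', v) X = 0.
Proof.
move=> ne; elim: k X => [|k IHk] X; first by move=> X0 h u h' v; rewrite -[X]id_lfunE X0.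
move=> X0; apply: IHk; apply: entry_sylv_neq0 => // h u h' v.
by have := X0 h u h' v; rewrite /= comp_lfunE.
Qed.

(** The generating polynomial of the entries met along a diagonal from the levels
    (r, s) on. *)
Definition diag_poly i j u v r s X : {poly F} :=
  \poly_(e < size (beta j)) entry (i, (r + e)%N, u) (j, (s + e)%N, v) X.

Lemma coef_diag_poly i j u v r s X e :
  (diag_poly i j u v r s X)`_e = entry (i, (r + e)%N, u) (j, (s + e)%N, v) X.
Proof.
rewrite coef_poly; case: ltnP => // le.
rewrite entry_invalidr // /valid_pos /= nth_default // (leq_trans le) //; exact: leq_addl.
Qed.

(** One step multiplies the polynomial by 1 - X and moves one row up.  Starting on
    the border is essential: the first entry of the diagonal then has no left
    neighbour that could contribute. *)
Lemma entry_sylv_pow i j u v r s k X e : lam i = mu j ->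
  (r == 0)%N || (s == 0)%N -> (k <= r + e)%N -> valid_pos beta (j, (s + e)%N, v) ->
  entry (i, (r + e - k)%N, u) (j, (s + e)%N, v) (lpow phiAB k X)
  = ((1 - 'X) ^+ k * diag_poly i j u v r s X)`_e.
Proof.
move=> eq0 rs; elim: k e => [|k IHk] e ke vq.
  by rewrite subn0 mul1r coef_diag_poly id_lfunE.
rewrite /= comp_lfunE entry_sylv // eq0 subrr mul0r add0r exprS -mulrA coef_N1XM.
rewrite subnSK // IHk //; last exact: ltnW.
congr (_ - _); case: e ke vq => [|e] ke vq.
  by case: s rs vq {IHk} => // s; rewrite orbF => /eqP r0; move: ke; rewrite r0.
rewrite [in LHS]addnS -IHk; last 2 first.
- by rewrite -ltnS -addnS.
- by apply: valid_down vq => //; rewrite addnS.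
by rewrite [(r + e.+1)%N]addnS subSS.
Qed.

Lemma ker_diag_poly i j u v r s k X e : X \in lker (lpow phiAB k) -> lam i = mu j ->
  (r == 0)%N || (s == 0)%N -> (k <= r + e)%N -> valid_pos beta (j, (s + e)%N, v) ->
  ((1 - 'X) ^+ k * diag_poly i j u v r s X)`_e = 0.
Proof.
rewrite memv_ker => /eqP X0 eq0 rs ke vq.
by rewrite -entry_sylv_pow // X0 linear0.
Qed.

(** Converse of [ker_diag_poly]: each position of the k-th image is reached from a
    diagonal that starts on the border. *)
Lemma diag_poly_ker k X :
  (forall i j (h u h' v : nat), lam i != mu j -> entry (i, h, u) (j, h', v) X = 0) ->
  (forall i j (u v r s e : nat), lam i = mu j -> (r == 0)%N || (s == 0)%N ->
     (k <= r + e)%N -> valid_pos beta (j, (s + e)%N, v) ->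
     ((1 - 'X) ^+ k * diag_poly i j u v r s X)`_e = 0) ->
  X \in lker (lpow phiAB k).
Proof.
move=> Xne Xeq; rewrite memv_ker; apply/eqP/entry_inj => -[[i h] u] [[j h'] v].
case: (boolP (valid_pos beta (j, h', v))) => vq; last exact: entry_invalidr.
case: (eqVneq (lam i) (mu j)) => [eq0|ne]; last first.
  by apply: entry_sylv_pow_block => *; apply: Xne.
case: (leqP h' (h + k)) => hk.
  have ke : (k <= h + k - h' + h')%N by rewrite subnK // leq_addl.
  have := @entry_sylv_pow i j u v (h + k - h')%N 0 k X h' eq0 (orbT _) ke vq.
  by rewrite subnK // addnK add0n => ->; apply: Xeq; rewrite ?orbT.
have e : (h' - (h + k) + (h + k) = h')%N by rewrite subnK // ltnW.
have vq' : valid_pos beta (j, (h' - (h + k) + (h + k))%N, v) by rewrite e.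
have := @entry_sylv_pow i j u v 0 (h' - (h + k))%N k X (h + k)%N eq0 isT (leq_addl _ _) vq'.
by rewrite add0n addnK e => ->; apply: Xeq => //; apply: leq_addl.
Qed.

End Kernel.

(** * A basis of the kernel of a power, in coordinates *)

Lemma mem_triples p q k r s l :
  ((r, s, l) \in triples p q k) =
  [&& s == 1%N, (2 <= r <= minn p k)%N & (l <= minn (p - r) (q - 1))%N]
  || [&& r == 1%N, (1 <= s <= q)%N & (l <= minn (p - 1) (q - s))%N].
Proof.
rewrite /triples mem_cat; congr (_ || _).
  apply/allpairsPdep/and3P => [[r' [l' [rr ll [-> -> ->]]]]|[/eqP-> rr ll]].
    by move: rr ll; rewrite !mem_iota => rr ll; split=> //; lia.
  by exists r, l; rewrite !mem_iota; split=> //; lia.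
apply/allpairsPdep/and3P => [[r' [l' [rr ll [-> -> ->]]]]|[/eqP-> rr ll]].
  by move: rr ll; rewrite !mem_iota => rr ll; split=> //; lia.
by exists s, l; rewrite !mem_iota; split=> //; lia.
Qed.

(** The list [triples] enumerates the positions of the diagonals that start on the
    border above row k; lower diagonals meet the kernel of the k-th power only
    in 0. *)
Lemma start_triples (p q k r s e : nat) : (r == 0)%N || (s == 0)%N ->
  (r + e < p)%N -> (s + e < q)%N -> (r < k)%N -> (r.+1, s.+1, e) \in triples p q k.
Proof.
rewrite mem_triples; case: r => [_ h1 h2 h3|r /= /eqP-> h1 h2 h3].
  by apply/orP; right; apply/and3P; split=> //; lia.
by apply/orP; left; apply/and3P; split=> //; lia.
Qed.

Lemma uniq_triples p q k : uniq (triples p q k).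
Proof.
rewrite /triples cat_uniq; apply/and3P; split.
- apply: allpairs_uniq_dep => [||[r l] [r' l'] _ _ /= [-> ->] //]; first exact: iota_uniq.
  by move=> r _; apply: iota_uniq.
- apply/hasPn => -[[r s] l] /allpairsPdep[s' [l' [_ _ [-> _ _]]]].
  apply/negP => /allpairsPdep[r'' [l'' [+ _ [r1 _ _]]]].
  by rewrite mem_iota -r1.
- apply: allpairs_uniq_dep => [||[r l] [r' l'] _ _ /= [-> ->] //]; first exact: iota_uniq.
  by move=> r _; apply: iota_uniq.
Qed.

Lemma mem_unit_positions al be k r s l u v :
  ((u, v) \in unit_positions al be k r s l) =
  (1 <= u <= term al (r + l))%N
  && (term be (1 + k - r + s + l) < v <= term be (s + l))%N.
Proof.
apply/allpairsPdep/andP => [[u' [v' [uu vv [-> ->]]]]|[uu vv]].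
  by move: uu vv; rewrite !mem_iota => uu vv; split=> //; lia.
by exists u, v; rewrite !mem_iota; split=> //; lia.
Qed.

Lemma uniq_unit_positions al be k r s l : uniq (unit_positions al be k r s l).
Proof.
apply: allpairs_uniq_dep => [||[u v] [u' v'] _ _ /= [-> ->] //]; first exact: iota_uniq.
by move=> u _; apply: iota_uniq.
Qed.

Definition label a b : eqType := ('I_a * 'I_b * (nat * nat * nat) * (nat * nat))%type.

(** The index set of [ker_basis], numbered from 1 as there. *)
Definition labels (F : fieldType) a b (lam : 'I_a -> F) (mu : 'I_b -> F)
    (alpha : 'I_a -> seq nat) (beta : 'I_b -> seq nat) k : seq (label a b) :=
  flatten [seq [seq (ij, w, uv)
         | w <- triples (size (alpha ij.1)) (size (beta ij.2)) k,
           uv <- let: (r, s, l) := w in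
                 unit_positions (alpha ij.1) (beta ij.2) k r s l]
    | ij <- enum [pred ij : 'I_a * 'I_b | lam ij.1 == mu ij.2]].

Lemma same_start (r s r' s' e t : nat) : (0 < r)%N -> (0 < s)%N ->
  (r == 1)%N || (s == 1)%N -> (r' == 0)%N || (s' == 0)%N ->
  (r' + e = (r + t).-1)%N -> (s' + e = (s + t).-1)%N ->
  [/\ r'.+1 = r, s'.+1 = s & e = t].
Proof. by move=> r0 s0 /orP[]/eqP-> /orP[]/eqP-> e1 e2; split; lia. Qed.

Lemma same_diagonal (r s r' s' e t : nat) : (0 < r)%N -> (0 < s)%N ->
  (0 < r')%N -> (0 < s')%N ->
  (r == 1)%N || (s == 1)%N -> (r' == 1)%N || (s' == 1)%N ->
  (r + e).-1 = (r' + t).-1 -> (s + e).-1 = (s' + t).-1 ->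
  [/\ r = r', s = s' & e = t].
Proof. by move=> r0 s0 r0' s0' /orP[]/eqP-> /orP[]/eqP-> e1 e2; split; lia. Qed.

Section Labels.
Variables (F : fieldType) (a b : nat) (lam : 'I_a -> F) (mu : 'I_b -> F).
Variables (alpha : 'I_a -> seq nat) (beta : 'I_b -> seq nat) (k : nat).

Lemma mem_labels (i : 'I_a) (j : 'I_b) (r s l u v : nat) :
  ((i, j, (r, s, l), (u, v)) \in labels lam mu alpha beta k) =
  [&& lam i == mu j, (r, s, l) \in triples (size (alpha i)) (size (beta j)) k
    & (u, v) \in unit_positions (alpha i) (beta j) k r s l].
Proof.
apply/flatten_mapP/and3P => [[[i' j'] ij /allpairsPdep[[[r' s'] l'] [[u' v']]]]|].
  by case=> ww uv [-> -> -> -> -> -> ->]; split=> //; move: ij; rewrite mem_enum.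
case=> ij ww uv; exists (i, j); first by rewrite mem_enum.
by apply/allpairsPdep; exists (r, s, l), (u, v).
Qed.

Lemma label_bounds (i : 'I_a) (j : 'I_b) (r s l u v : nat) :
  (i, j, (r, s, l), (u, v)) \in labels lam mu alpha beta k ->
  [/\ (r == 1)%N || (s == 1)%N, (0 < r)%N, (0 < s)%N, (0 < u)%N & (0 < v)%N].
Proof.
rewrite mem_labels mem_triples mem_unit_positions => /and3P[_ T /andP[/andP[u0 _]]].
move=> /andP[v0 _]; case/orP: T => /and3P[/eqP-> /andP[r0 _] _]; split; rewrite ?orbT //.
- exact: ltnW.
- exact: leq_ltn_trans v0.
- exact: leq_ltn_trans v0.
Qed.

Lemma uniq_labels : uniq (labels lam mu alpha beta k).
Proof.
rewrite /labels; set f := fun ij : 'I_a * 'I_b => _.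
have uf ij : uniq (f ij).
  rewrite /f; apply: allpairs_uniq_dep => [|[[r s] l] _|]; first exact: uniq_triples.
    exact: uniq_unit_positions.
  by move=> [w uv] [w' uv'] _ _ /= [-> ->].
have disj ij ij' z : z \in f ij -> z \in f ij' -> ij = ij'.
  by move=> /allpairsPdep[w [uv [_ _ ->]]] /allpairsPdep[w' [uv' [_ _ []]]].
elim: (enum _) (enum_uniq [pred ij : 'I_a * 'I_b | lam ij.1 == mu ij.2]) => //= ij e IH.
case/andP => ije ue; rewrite cat_uniq uf IH // andbT; apply/hasPn => z.
case/flatten_mapP => ij' ij'e zij'; apply: contra ije => zij.
by rewrite (disj _ _ _ zij zij').
Qed.

End Labels.

Section KernelBasis.
Variables (F : numFieldType) (a b : nat) (lam : 'I_a -> F) (mu : 'I_b -> F).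
Variables (alpha : 'I_a -> seq nat) (beta : 'I_b -> seq nat).
Variables (M N : nat) (posA : 'I_M -> 'I_a * nat * nat) (posB : 'I_N -> 'I_b * nat * nat).
Hypotheses (posAP : weyr_coords alpha posA) (posBP : weyr_coords beta posB).
Hypotheses (alphaP : forall i, nonincr (alpha i)) (betaP : forall j, nonincr (beta j)).
Variables (k : nat) (x : 'I_a -> 'I_b -> nat -> nat -> nat -> nat -> F).
Hypothesis k_gt0 : (0 < k)%N.

Implicit Types (i : 'I_a) (j : 'I_b) (r s l u v e t : nat).

Definition chain_poly (y : nat -> F) l : {poly F} := \poly_(t < l.+1) y t.

(** The form taken by [chain_sol] on the polynomial of the chain; the last
    coefficient is nonzero in all cases, by [chain_poly_last]. *)
Definition poly_sol q r s l (y : nat -> F) : Prop :=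
  (forall t, (t <= l)%N -> (k - r + s + t <= q)%N ->
     ((1 - 'X) ^+ k.-1 * chain_poly y l)`_(k - r + t) = 1) /\ y l != 0.

Hypothesis xP : forall i j r s l, lam i = mu j ->
  (r, s, l) \in triples (size (alpha i)) (size (beta j)) k ->
  poly_sol (size (beta j)) r s l (x i j r s l).

(** The predecessors translate the numbering from 1 of the labels into positions
    numbered from 0. *)
Definition label_mx (w : label a b) : 'M[F]_(M, N) :=
  let: (i, j, (r, s, l), (u, v)) := w in
  \sum_(0 <= t < l.+1) x i j r s l t *:
    ((pos_row F posA (i, (r + t).-1, u.-1))^T *m pos_row F posB (j, (s + t).-1, v.-1)).

Lemma entry_label_mx p q i j r s l u v :
  entry posA posB p q (label_mx (i, j, (r, s, l), (u, v))) =
  \sum_(0 <= t < l.+1) x i j r s l t *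
    [&& p == (i, (r + t).-1, u.-1), q == (j, (s + t).-1, v.-1),
        valid_pos alpha p & valid_pos beta q]%:R.
Proof.
rewrite /label_mx linear_sum; apply: eq_bigr => t _ /=; rewrite linearZ /=; congr (_ * _).
rewrite /entry mulmxA (pos_row_tr _ posAP) mul_scalar_mx -scalemxAl.
have -> : pos_row F posB (j, (s + t).-1, v.-1) *m (pos_row F posB q)^T =
   (pos_row F posB q *m (pos_row F posB (j, (s + t).-1, v.-1))^T)^T.
  by rewrite trmx_mul trmxK.
rewrite (pos_row_tr _ posBP) tr_scalar_mx !mxE eqxx mulr1n -natrM mulnb.
by congr (_%:R); congr nat_of_bool; rewrite -!andbA; do !bool_congr.
Qed.

Let phiAB := sylv (weyr_mx lam posA) (weyr_mx mu posB).

Lemma label_valid i j r s l u v t : (i, j, (r, s, l), (u, v)) \in labels lam mu alpha beta k ->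
  (t <= l)%N -> valid_pos alpha (i, (r + t).-1, u.-1) && valid_pos beta (j, (s + t).-1, v.-1).
Proof.
rewrite mem_labels mem_triples mem_unit_positions => /and3P[_ T /andP[uu vv]] tl.
have ru : valid_pos alpha (i, (r + l).-1, u.-1) by rewrite /valid_pos /= /term in uu *; lia.
have sv : valid_pos beta (j, (s + l).-1, v.-1) by rewrite /valid_pos /= /term in vv *; lia.
by apply/andP; split; [apply: valid_down ru | apply: valid_down sv] => //; lia.
Qed.

Lemma diag_poly_label_mx i j r s l u v i' j' u' v' r' s' :
  (i, j, (r, s, l), (u, v)) \in labels lam mu alpha beta k ->
  (r' == 0)%N || (s' == 0)%N ->
  diag_poly beta posA posB i' j' u' v' r' s' (label_mx (i, j, (r, s, l), (u, v))) =
  if [&& i' == i, j' == j, u'.+1 == u, v'.+1 == v, r'.+1 == r & s'.+1 == s]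
  then chain_poly (x i j r s l) l else 0.
Proof.
move=> ww rs; apply/polyP => e; rewrite (coef_diag_poly _ posBP) entry_label_mx.
have [rs1 r0 s0 u0 v0] := label_bounds ww.
case: ifP => [/and5P[/eqP-> /eqP-> /eqP ue /eqP ve /andP[/eqP re /eqP se]]|cond].
  rewrite coef_poly; case: ltnP => el; last first.
    rewrite big_nat big1 // => t tl; rewrite !xpair_eqE -re -se !addSn /= eqn_add2l.
    by rewrite (_ : (e == t) = false) ?andbF ?mulr0 //; lia.
  have := label_valid ww el => /andP[]; rewrite -re -se -ue -ve !addSn /= => va vb.
  rewrite (bigD1_seq e) ?mem_index_iota ?iota_uniq //=.
  rewrite /= !eqxx va vb mulr1 big1 ?addr0 // => t te.
  by rewrite !xpair_eqE !eqn_add2l eq_sym (negPf te) ?andbF ?mulr0.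
rewrite coef0 big_nat big1 // => t tl; rewrite (_ : [&& _, _, _ & _] = false) ?mulr0 //.
apply: contraFF cond => /and4P[]; rewrite !xpair_eqE.
move=> /andP[/andP[/eqP-> /eqP e1] /eqP e2] /andP[/andP[/eqP-> /eqP e3] /eqP e4] _ _.
have [-> -> _] := same_start r0 s0 rs1 rs e1 e3.
by rewrite e2 e4 !prednK // !eqxx.
Qed.

(** One more factor 1 - X turns the window of ones of the chain into a window of
    zeros.  The lower bound on v in [unit_positions] says that the levels having
    rank v end inside this window. *)
Lemma label_mx_ker w : w \in labels lam mu alpha beta k ->
  label_mx w \in lker (lpow phiAB k).
Proof.
move: w => [[[i j] [[r s] l]] [u v]] ww.
have := ww; rewrite mem_labels mem_unit_positions => /and3P[/eqP eq0 T /andP[uu vv]].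
have [sol _] := xP eq0 T; move: (T); rewrite mem_triples => T'.
apply: (diag_poly_ker posAP posBP) => // [i' j' h u' h' v' ne|i' j' u' v' r' s' e eq0' rs ke vq].
  rewrite entry_label_mx big1 // => t _; rewrite (_ : [&& _, _, _ & _] = false) ?mulr0 //.
  apply: contraNF ne => /and4P[]; rewrite !xpair_eqE.
  by move=> /andP[/andP[/eqP-> _] _] /andP[/andP[/eqP-> _] _] _ _; rewrite eq0.
rewrite (diag_poly_label_mx _ _ _ _ ww rs).
case: ifP => [/and5P[/eqP ie /eqP je /eqP ue /eqP ve /andP[/eqP re /eqP se]]|_]; last first.
  by rewrite mulr0 coef0.
have sq : (s' + e < size (beta j))%N.
  by rewrite ltnNge; apply/negP => le; move: vq; rewrite /valid_pos je /= nth_default.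
have el : (s' + e < k - r + s + l)%N.
  rewrite ltnNge; apply/negP => le; move: vq; rewrite /valid_pos je /= ltnNge => /negP; apply.
  apply: leq_trans (nonincr_le (@betaP j) le) _; move: vv; rewrite /term.
  by rewrite (_ : (1 + k - r + s + l).-1 = k - r + s + l)%N; lia.
case: e sq el ke vq => [|e] sq el ke vq; first by lia.
rewrite -(prednK k_gt0) exprS -mulrA coef_N1XM.
have := sol (e - (k - r))%N; have := sol (e.+1 - (k - r))%N.
rewrite !subnKC; [|lia..] => -> ; [|lia..] => ->; [|lia..].
by rewrite subrr.
Qed.

(** The functional of a label is the entry at the end (r + l, s + l) of its chain,
    and [rho] is l: any other chain through this position ends later on the
    same diagonal.  If all these entries of a matrix X of the kernel vanish, its
    polynomial on the border diagonal from (r, s) has size at most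
    Q - s - (k - r), where Q is the number of levels having rank v.  This is also
    the length of the window of zeros, so [window_eq0] applies. *)
Lemma label_basis :
  basis_of (lker (lpow phiAB k)) (map label_mx (labels lam mu alpha beta k)).
Proof.
pose phi (w : label a b) : {scalar 'M[F]_(M, N)} :=
  let: (i, j, (r, s, l), (u, v)) := w in
  entry posA posB (i, (r + l).-1, u.-1) (j, (s + l).-1, v.-1).
pose rho (w : label a b) := let: (i, j, (r, s, l), (u, v)) := w in l.
apply: (triangular_basis (phi := phi) (rho := rho)).
- exact: uniq_labels.
- exact: label_mx_ker.
- move=> [[[i j] [[r s] l]] [u v]] ww; rewrite /phi /= entry_label_mx.
  have := label_valid ww (leqnn l) => /andP[-> ->].
  have := ww; rewrite mem_labels => /and3P[/eqP eq0 T _].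
  have [_ xl] := xP eq0 T.
  have := T; rewrite mem_triples => T'.
  rewrite big_nat_recr //= !eqxx mulr1 big_nat big1 ?add0r // => t tl.
  rewrite !xpair_eqE (_ : ((r + l).-1 == (r + t).-1) = false) ?andbF ?mulr0 //.
  by lia.
- move=> [[[i j] [[r s] l]] [u v]] [[[i' j'] [[r' s'] l']] [u' v']] ww ww' ne ll.
  rewrite /phi /= entry_label_mx big_nat big1 // => t tl.
  rewrite (_ : [&& _, _, _ & _] = false) ?mulr0 //.
  apply: contraNF ne => /and4P[]; rewrite !xpair_eqE.
  have [rs1 r0 s0 u0 v0] := label_bounds ww.
  have [rs1' r0' s0' u0' v0'] := label_bounds ww'.
  move=> /andP[/andP[/eqP-> /eqP e1] /eqP e2] /andP[/andP[/eqP-> /eqP e3] /eqP e4] _ _.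
  have [-> -> lt] := same_diagonal r0 s0 r0' s0' rs1 rs1' e1 e3.
  have -> : l = l'.
    by apply/eqP; rewrite eqn_leq; apply/andP; split=> //; rewrite lt.
  by rewrite -(prednK u0) e2 (prednK u0') -(prednK v0) e4 (prednK v0') !eqxx.
- move=> X Xk phi0; apply: (entry_inj posAP posBP) => -[[i h] u] [[j h'] v].
  case: (eqVneq (lam i) (mu j)) => [eq0|ne]; last first.
    apply: (entry_sylv_pow_neq0 (k := k) posAP posBP alphaP ne).
    by move=> *; move: Xk; rewrite memv_ker => /eqP ->; rewrite linear0.
  (* The diagonal through (h, h') leaves the border at (r, s). *)
  pose r := (h - h')%N; pose s := (h' - h)%N; pose e := minn h h'.
  have rs : (r == 0)%N || (s == 0)%N by rewrite /r /s; lia.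
  have -> : h = (r + e)%N by rewrite /r /e; lia.
  have -> : h' = (s + e)%N by rewrite /s /e; lia.
  rewrite -(coef_diag_poly _ posBP).
  have [Q Qs QP] := nonincr_height v (@betaP j).
  suff -> : diag_poly beta posA posB i j u v r s X = 0 by rewrite coef0.
  apply: (@window_eq0 _ k (k - r) (Q - s - (k - r))) => [||t tQ]; first exact: leq_subr.
    apply/leq_sizeP => e' le; rewrite (coef_diag_poly _ posBP).
    case: (boolP (valid_pos beta (j, (s + e')%N, v))) => vq; last exact: (entry_invalidr _ posBP).
    case: (boolP (valid_pos alpha (i, (r + e')%N, u))) => vp; last exact: (entry_invalidl _ posAP).
    have seQ : (s + e' < Q)%N by rewrite -QP.
    have := phi0 (i, j, (r.+1, s.+1, e'), (u.+1, v.+1)); rewrite /phi !addSn /=; apply.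
    have seq : (s + e' < size (beta j))%N by apply: leq_trans seQ Qs.
    have rep : (r + e' < size (alpha i))%N.
      by rewrite ltnNge; apply/negP => le'; move: vp; rewrite /valid_pos /= nth_default.
    have below : (nth 0%N (beta j) (1 + k - r.+1 + s.+1 + e').-1 <= v)%N.
      by rewrite leqNgt QP; lia.
    have rk : (r < k)%N by lia.
    rewrite mem_labels mem_unit_positions eq0 eqxx (start_triples rs rep seq rk) /=.
    move: vp vq below; rewrite /valid_pos /= /term !addSn /= => -> -> below.
    by rewrite andbT ltnS; exact: below.
  apply: (ker_diag_poly posAP posBP alphaP betaP _ Xk eq0) => //; first lia.
  by rewrite /valid_pos /= QP; lia.
Qed.

End KernelBasis.

(** * Block matrices and chain coefficients in coordinates *)

Section Positions.

(** Cancellation of the block decomposition under a function of the block and of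
    the index inside it, which avoids casts. *)
Lemma sig_Rank n (p_ : 'I_n -> nat) T (f : forall i, 'I_(p_ i) -> T) i (y : 'I_(p_ i)) :
  f (tagnat.sig1 (tagnat.Rank i y)) (tagnat.sig2 (tagnat.Rank i y)) = f i y.
Proof.
pose g (t : {i & 'I_(p_ i)}) := f (tag t) (tagged t).
by rewrite -[LHS]/(g (tagnat.sig (tagnat.rank (Tagged _ y)))) tagnat.rankK.
Qed.

Lemma sig_eq n (p_ : 'I_n -> nat) (x y : 'I_(\sum_i p_ i)) :
  (x == y) = (tagnat.sig1 x == tagnat.sig1 y)
             && (tagnat.sig2 x == tagnat.sig2 y :> nat).
Proof. by rewrite -val_eqE -{1}[x]tagnat.sig2K -{1}[y]tagnat.sig2K tagnat.eq_Rank. Qed.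

Definition block_pos (s : seq nat) (x : 'I_(weight s)) : nat * nat :=
  (val (tagnat.sig1 x), val (tagnat.sig2 x)).

Lemma block_pos_eq s (x y : 'I_(weight s)) : (block_pos x == block_pos y) = (x == y).
Proof. by rewrite sig_eq. Qed.

Lemma block_pos_ex s h u : (u < nth 0%N s h)%N <-> exists x : 'I_(weight s), block_pos x = (h, u).
Proof.
split=> [us|[x]]; last by case=> <- <-; exact: (ltn_ord (tagnat.sig2 x)).
have hs : (h < size s)%N.
  by rewrite ltnNge; apply/negP => le; move: us; rewrite nth_default.
pose y : 'I_(block_size (Ordinal hs)) := Ordinal us.
exists (tagnat.Rank (Ordinal hs) y).
by rewrite /block_pos (sig_Rank (fun i (z : 'I_(block_size i)) => (val i, val z))).
Qed.

Definition weyr_pos a (alpha : 'I_a -> seq nat) (x : 'I_(\sum_i weight (alpha i))) :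
    'I_a * nat * nat :=
  (tagnat.sig1 x, (block_pos (tagnat.sig2 x)).1, (block_pos (tagnat.sig2 x)).2).

Lemma weyr_pos_coords a (alpha : 'I_a -> seq nat) : weyr_coords alpha (@weyr_pos a alpha).
Proof.
split=> [x y /eqP|[[i h] u]].
  rewrite /weyr_pos !xpair_eqE => e; apply/eqP; rewrite sig_eq.
  move: (tagnat.sig1 x) (tagnat.sig1 y) (tagnat.sig2 x) (tagnat.sig2 y) e.
  move=> i i' k k' /andP[/andP[/eqP ii']]; case: _ / ii' k' => k' h u; rewrite eqxx /=.
  have /eqP-> // : k == k' by rewrite -block_pos_eq -pair_eqE /pair_eq /= h.
split=> [[x <-]|us].
  exact: (ltn_ord (tagnat.sig2 (tagnat.sig2 x))).
have [y py] := proj1 (block_pos_ex _ _ _) us.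
exists (tagnat.Rank i y).
rewrite /weyr_pos (sig_Rank (fun i (z : 'I_(weight (alpha i))) =>
                               (i, (block_pos z).1, (block_pos z).2))).
by rewrite py.
Qed.

Definition nilp_pos s (x : 'I_(weight s)) : 'I_1 * nat * nat :=
  (ord0, (block_pos x).1, (block_pos x).2).

Lemma nilp_pos_coords s : weyr_coords (fun _ : 'I_1 => s) (@nilp_pos s).
Proof.
split=> [x y|[[i h] u]].
  by case=> h u; apply/eqP; rewrite -block_pos_eq; apply/eqP; congr pair.
split=> [[x <-]|us].
  exact: (ltn_ord (tagnat.sig2 x)).
have [y py] := proj1 (block_pos_ex _ _ _) us.
by exists y; rewrite /nilp_pos py (ord1 i).
Qed.

(** The Jordan block is the Weyr matrix of (1, ..., 1): all ranks are 0. *)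
Definition jordan_pos p (x : 'I_p) : 'I_1 * nat * nat := (ord0, val x, 0%N).

Lemma jordan_pos_coords p : weyr_coords (fun _ : 'I_1 => nseq p 1%N) (@jordan_pos p).
Proof.
split=> [x y [] /val_inj //|[[i h] u]].
rewrite /valid_pos /= nth_nseq; split=> [[x [_ <- <-]]|]; first by rewrite ltn_ord.
case: (ltnP h p) => // hp; rewrite ltnS leqn0 => /eqP->.
by exists (Ordinal hp); rewrite /jordan_pos (ord1 i).
Qed.

Lemma nonincr_nseq p : nonincr (nseq p 1%N).
Proof. by move=> h; rewrite !nth_nseq; case: (ltnP h.+1 p) => // /ltnW ->. Qed.

End Positions.

Section Forms.
Variable F : fieldType.

Lemma nilp_weyrE s (x y : 'I_(weight s)) :
  nilp_weyr F s x y = (block_pos y == ((block_pos x).1.+1, (block_pos x).2))%:R.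
Proof.
rewrite /nilp_weyr mxE /block_pos xpair_eqE /=.
case: eqP => [e|]; last by rewrite mxE.
rewrite mxE /= eq_sym; case: eqP => // <-.
by rewrite ltn_ord.
Qed.

Lemma nilp_weyr_coords s :
  nilp_weyr F s = weyr_mx (fun _ : 'I_1 => 0) (@nilp_pos s).
Proof.
by apply/matrixP => x y; rewrite nilp_weyrE mxE mulr0 add0r /nilp_pos -pair_eqE.
Qed.

Lemma nilp_jordan_coords p :
  nilp_jordan F p = weyr_mx (fun _ : 'I_1 => 0) (@jordan_pos p).
Proof.
apply/matrixP => x y; rewrite !mxE mulr0 add0r /nilp_jordan summxE.
rewrite /jordan_pos !xpair_eqE eqxx /= andbT.
case: eqP => [e|ne].
  rewrite (bigD1_seq x.+1) ?mem_index_iota ?iota_uniq //=; last first.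
    by rewrite -e ltn_ord.
  rewrite mxE e !eqxx big1 ?addr0 // => h hx.
  by rewrite mxE eq_sym (negPf hx).
rewrite big1 // => h _; rewrite mxE; case: eqP => // <-.
by rewrite eqSS; case: eqP.
Qed.

Lemma weyr_form_coords a (lam : 'I_a -> F) (alpha : 'I_a -> seq nat) :
  weyr_form lam alpha = weyr_mx lam (@weyr_pos a alpha).
Proof.
apply/matrixP => x y; rewrite mxE [RHS]mxE sig_eq /weyr_pos.
move: (tagnat.sig1 x) (tagnat.sig1 y) (tagnat.sig2 x) (tagnat.sig2 y) => i j k k' /=.
case: (eqVneq i j) => [e|ne]; last first.
  by rewrite mxE mul0r add0r !xpair_eqE eq_sym (negPf ne).
case: _ / e k' => k'; rewrite conform_mx_id [LHS]mxE nilp_weyrE [X in X + _]mxE mulrC.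
congr (_ + _).
  by rewrite val_eqE /= mulr_natr.
by rewrite !xpair_eqE eqxx.
Qed.

End Forms.

Section BasisMx.
Variables (F : numFieldType) (a b : nat) (lam : 'I_a -> F) (mu : 'I_b -> F).
Variables (alpha : 'I_a -> seq nat) (beta : 'I_b -> seq nat).
Variables (k : nat) (x : 'I_a -> 'I_b -> nat -> nat -> nat -> nat -> F).

Lemma corner_ord p q p' q' (Z : 'M[F]_(p', q')) (y : 'I_p) (z : 'I_q) (y' : 'I_p') (z' : 'I_q') :
  y = y' :> nat -> z = z' :> nat -> corner p q Z y z = Z y' z'.
Proof. by move=> e e'; rewrite mxE e e' !valK. Qed.

Lemma corner_eunit p q p' q' u v (y : 'I_p) (z : 'I_q) : (u <= p')%N -> (v <= q')%N ->
  corner p q (eunit F p' q' u v) y z = ((y.+1 == u) && (z.+1 == v))%:R.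
Proof.
move=> up vq; rewrite mxE; case: insubP => [y' _ e|yp]; last first.
  by rewrite (_ : (y.+1 == u) = false) //; apply: contraNF yp => /eqP->.
case: insubP => [z' _ e'|zq]; last first.
  by rewrite (_ : (z.+1 == v) = false) ?andbF //; apply: contraNF zq => /eqP->.
by rewrite mxE e e'.
Qed.

Lemma ker_basis_mxE i j r s l u v :
  (i, j, (r, s, l), (u, v)) \in labels lam mu alpha beta k ->
  ker_basis_mx alpha beta i j r s l (x i j r s l) u v =
  label_mx (@weyr_pos a alpha) (@weyr_pos b beta) x (i, j, (r, s, l), (u, v)).
Proof.
move=> ww; have [_ r0 s0 u0 v0] := label_bounds ww.
move: ww; rewrite mem_labels mem_unit_positions => /and3P[_ _ /andP[uu vv]].
have ut : (u <= term (alpha i) (r + l))%N by case/andP: uu.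
have vt : (v <= term (beta j) (s + l))%N by case/andP: vv.
apply/matrixP => y z; rewrite mxE [RHS]summxE.
under [RHS]eq_bigr => t _ do rewrite !mxE big_ord1 !mxE -natrM mulnb /weyr_pos.
move: (tagnat.sig1 y) (tagnat.sig1 z) (tagnat.sig2 y) (tagnat.sig2 z) => i' j' y' z' /=.
rewrite !eqSS !val_eqE; case: (eqVneq i' i) => [e|ne]; last first.
  by rewrite mxE big1 // => t _; rewrite !xpair_eqE (negPf ne) mulr0.
case: (eqVneq j' j) => [e'|ne]; last first.
  by rewrite mxE big1 // => t _; rewrite !xpair_eqE (negPf ne) andbF mulr0.
subst i' j'; rewrite (corner_ord _ (y' := y') (z' := z')) // summxE.
apply: eq_bigr => t _; rewrite !mxE; congr (_ * _).
rewrite !xpair_eqE !eqxx /block_pos /=.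
move: (tagnat.sig1 y') (tagnat.sig1 z') (tagnat.sig2 y') (tagnat.sig2 z') => h h' c c' /=.
have pr n m : (0 < m)%N -> (n == m.-1) = (n.+1 == m) by case: m.
rewrite !pr ?addn_gt0 ?r0 ?s0 //.
case: (h.+1 == _) => /=; last by rewrite mxE.
case: (h'.+1 == _); last by rewrite andbF mxE.
by rewrite corner_eunit.
Qed.

Lemma ker_basis_labels :
  ker_basis lam mu alpha beta k x =
  map (label_mx (@weyr_pos a alpha) (@weyr_pos b beta) x) (labels lam mu alpha beta k).
Proof.
rewrite [RHS](_ : _ = map (fun w : label a b => let: (ij, (r, s, l), (u, v)) := w in
   ker_basis_mx alpha beta ij.1 ij.2 r s l (x ij.1 ij.2 r s l) u v)
   (labels lam mu alpha beta k)); last first.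
  apply/eq_in_map => -[[[i j] [[r s] l]] [u v]] ww; by rewrite ker_basis_mxE.
rewrite /labels map_flatten -map_comp /ker_basis; congr flatten; apply: eq_map => ij /=.
rewrite map_allpairs; apply/eq_in_allpairs_dep => -[[r s] l] _ [u v] _ //.
Qed.

End BasisMx.

Section Chain.
Variables (F : numFieldType) (p q k r s l : nat).
Hypotheses (p_gt0 : (0 < p)%N) (q_gt0 : (0 < q)%N).
Hypotheses (k_gt0 : (0 < k)%N) (T : (r, s, l) \in triples p q k).

Let Y (y : nat -> F) : 'M[F]_(p, q) :=
  \sum_(0 <= t < l.+1) y t *: eunit F p q (r + t) (s + t).

Lemma triples_bounds : [/\ (r == 1)%N || (s == 1)%N, (0 < r <= k)%N, (0 < s)%N,
  (r + l <= p)%N & (s + l <= q)%N].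
Proof.
move: T; rewrite mem_triples => /orP[] /and3P[/eqP-> h1 h2]; split; rewrite ?orbT //; lia.
Qed.

(** The sum on the left of [chain_eq] is supported by the diagonal from (r, s), so
    [entry_sylv_pow] computes its image. *)
Lemma chain_lhsE y (h : 'I_p) (h' : 'I_q) :
  lpow (sylv (nilp_jordan F p) (nilp_jordan F q)) k.-1 (Y y) h h' =
  if (h'.+1 == k - r + s + h)%N
  then ((1 - 'X) ^+ k.-1 * chain_poly y l)`_(k - r + h) else 0.
Proof.
have [rs1 /andP[r0 rk] s0 rp sq] := triples_bounds.
have nn n : forall i : 'I_1, nonincr (nseq n 1%N) by move=> _; apply: nonincr_nseq.
have entY (f g : nat) : entry (@jordan_pos p) (@jordan_pos q) (ord0, f, 0%N) (ord0, g, 0%N) (Y y) =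
    \sum_(0 <= t < l.+1) y t * ((f.+1 == r + t)%N && (g.+1 == s + t)%N)%:R.
  case: (ltnP f p) => fp; last first.
    rewrite (entry_invalidl _ (jordan_pos_coords p));
      last by rewrite /valid_pos /= nth_nseq ifN -?leqNgt.
    rewrite big_nat big1 // => t tl; rewrite (_ : (f.+1 == _)%N = false) ?mulr0 //; lia.
  case: (ltnP g q) => gq; last first.
    rewrite (entry_invalidr _ (jordan_pos_coords q));
      last by rewrite /valid_pos /= nth_nseq ifN -?leqNgt.
    rewrite big_nat big1 // => t tl; rewrite (_ : (g.+1 == _)%N = false) ?andbF ?mulr0 //; lia.
  rewrite -[(_, f, _)]/(jordan_pos (Ordinal fp)) -[(_, g, _)]/(jordan_pos (Ordinal gq)).
  rewrite (entryE (jordan_pos_coords p) (jordan_pos_coords q)) summxE.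
  by apply: eq_bigr => t _; rewrite !mxE.
have diagY (r' s' : nat) : (r' == 0)%N || (s' == 0)%N ->
    diag_poly (fun _ : 'I_1 => nseq q 1%N) (@jordan_pos p) (@jordan_pos q) ord0 ord0 0 0
      r' s' (Y y) =
    if (r'.+1 == r) && (s'.+1 == s) then chain_poly y l else 0.
  move=> rs; apply/polyP => e; rewrite (coef_diag_poly _ (jordan_pos_coords q)) entY.
  case: ifP => [/andP[/eqP<- /eqP<-]|cond]; last first.
    rewrite coef0 big1 // => t _; case: andP => [[/eqP e1 /eqP e2]|]; rewrite ?mulr0 //.
    have [||e3 e4] := same_start r0 s0 rs1 rs (e := e) (t := t).
    - by rewrite -e1.
    - by rewrite -e2.
    by rewrite e3 e4 !eqxx in cond.
  rewrite coef_poly; case: ltnP => el.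
    rewrite (bigD1_seq e) ?mem_index_iota ?iota_uniq //= !addSn !eqxx mulr1.
    rewrite big1 ?addr0 // => t te; rewrite !addSn !eqSS !eqn_add2l eq_sym (negPf te).
    by rewrite mulr0.
  rewrite big_nat big1 // => t tl; rewrite !addSn !eqSS !eqn_add2l.
  by rewrite (_ : (e == t) = false) ?mulr0 //; lia.
rewrite !nilp_jordan_coords -(entryE (jordan_pos_coords p) (jordan_pos_coords q)).
have vq e : (e = h' :> nat) -> valid_pos (fun _ : 'I_1 => nseq q 1%N) (ord0, e, 0%N).
  by move=> ->; rewrite /valid_pos /= nth_nseq ltn_ord.
pose H := (h + k.-1)%N.
case: (leqP h' H) => hk.
  have ke : (k.-1 <= H - h' + h')%N by rewrite subnK // leq_addl.
  have := @entry_sylv_pow F 1 1 (fun=> 0) (fun=> 0) _ _ p q _ _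
    (jordan_pos_coords p) (jordan_pos_coords q)
    (nn p) (nn q) ord0 ord0 0%N 0%N (H - h')%N 0%N k.-1 (Y y) h' erefl (orbT _) ke (vq _ erefl).
  rewrite subnK // /H addnK add0n => ->; rewrite diagY ?orbT //.
  have -> : (((h + k.-1 - h').+1 == r) && (1 == s)%N) = (h'.+1 == k - r + s + h)%N
     && ((h + k.-1 - h').+1 == r) && (1 == s)%N by lia.
  case: eqP => [e|ne] /=; last by rewrite mulr0 coef0.
  case: ifP => [/andP[/eqP e1 /eqP e2]|]; last by lia.
  by congr (_`_ _); lia.
have e : (h' - H + H = h')%N by rewrite subnK // ltnW.
have := @entry_sylv_pow F 1 1 (fun=> 0) (fun=> 0) _ _ p q _ _
    (jordan_pos_coords p) (jordan_pos_coords q)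
    (nn p) (nn q) ord0 ord0 0%N 0%N 0%N (h' - H)%N k.-1 (Y y) H erefl isT (leq_addl _ _) (vq _ e).
rewrite e add0n {1}/H addnK => ->; rewrite diagY //.
case: ifP => [/andP[/eqP e1 /eqP e2]|cond].
  by rewrite ifT; [congr (_`_ _); rewrite /H|rewrite /H in e2 hk *]; lia.
by rewrite mulr0 coef0 ifF //; rewrite /H in cond hk *; lia.
Qed.

Lemma chain_eqP (y : nat -> F) : chain_eq p q k r s l y <->
  forall t, (t <= l)%N -> (k - r + s + t <= q)%N ->
     ((1 - 'X) ^+ k.-1 * chain_poly y l)`_(k - r + t) = 1.
Proof.
have [rs1 /andP[r0 rk] s0 rp sq] := triples_bounds.
have rhsE (y' : nat -> F) (h : 'I_p) (h' : 'I_q) :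
   (\sum_(0 <= t < l.+1) eunit F p q (1 + t) (k - r + s + t)
      + \sum_(l.+1 <= t < p) y' t *: eunit F p q (1 + t) (k - r + s + t)) h h'
   = if (h'.+1 == k - r + s + h)%N then (if (h <= l)%N then 1 else y' h) else 0.
  rewrite mxE !summxE.
  rewrite (eq_bigr (fun t => ((h == t :> nat) && (h'.+1 == k - r + s + t)%N)%:R)); last first.
    by move=> t _; rewrite mxE add1n eqSS.
  rewrite [X in _ + X](eq_bigr (fun t => y' t
     * ((h == t :> nat) && (h'.+1 == k - r + s + t)%N)%:R)); last first.
    by move=> t _; rewrite !mxE add1n eqSS.
  case: eqP => e; last first.
    rewrite !big1 ?addr0 // => t _; case: eqP => [ht|]; rewrite ?mulr0 //.
      by rewrite -ht; case: eqP; rewrite ?mulr0.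
    by rewrite -ht; case: eqP; rewrite ?mulr0.
  case: leqP => hl.
    rewrite (bigD1_seq (h : nat)) ?mem_index_iota ?iota_uniq //= eqxx e eqxx.
    rewrite big1 ?addr0 => [|t th]; last by rewrite eq_sym (negPf th).
    rewrite big_nat big1 ?addr0 // => t tl; rewrite (_ : (h == t :> nat) = false) ?mulr0 //; lia.
  rewrite big_nat big1 ?add0r => [|t tl]; last by rewrite (_ : (h == t :> nat) = false) //; lia.
  rewrite (bigD1_seq (h : nat)) ?mem_index_iota ?iota_uniq ?hl ?ltn_ord //= eqxx e eqxx mulr1.
  by rewrite big1 ?addr0 // => t th; rewrite eq_sym (negPf th) mulr0.
split=> [[y' Ey] t tl tq|sol].
  have tp : (t < p)%N by lia.
  have tq' : ((k - r + s + t).-1 < q)%N by lia.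
  have := congr1 (fun Z : 'M_(p, q) => Z (Ordinal tp) (Ordinal tq')) Ey.
  have e : ((k - r + s + t).-1.+1 == k - r + s + t)%N by lia.
  by rewrite chain_lhsE rhsE /= tl e.
exists (fun t => ((1 - 'X) ^+ k.-1 * chain_poly y l)`_(k - r + t)).
apply/matrixP => h h'; rewrite chain_lhsE rhsE; case: eqP => // e.
by case: leqP => // hl; rewrite sol // -e ltn_ord.
Qed.

(** For r <= k the window starts at k - r <= k - 1, as [window_last_neq0]
    requires. *)
Lemma chain_poly_last (y : nat -> F) :
  (forall t, (t <= l)%N -> ((1 - 'X) ^+ k.-1 * chain_poly y l)`_(k - r + t) = 1) -> y l != 0.
Proof.
have [rs1 /andP[r0 rk] s0 rp sq] := triples_bounds.
move=> sol; have := @window_last_neq0 _ k.-1 (k - r) l (chain_poly y l).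
by rewrite coef_poly ltnSn; apply; rewrite ?size_poly //; lia.
Qed.

Lemma chain_sol_poly (y : nat -> F) : chain_sol p q k r s l y -> poly_sol k q r s l y.
Proof.
case=> /chain_eqP sol yl; split=> //; case: (leqP (k - r + s + l) q) => kq; last exact: yl.
by apply: chain_poly_last => t tl; apply: sol => //; lia.
Qed.

(** The full window of l + 1 ones contains the shorter one that remains when
    columns beyond q are missing, so the same solution serves in both cases. *)
Lemma chain_sol_window : chain_sol p q k r s l (fun t => (window_sol F k.-1 (k - r) l.+1)`_t).
Proof.
have [rs1 /andP[r0 rk] s0 rp sq] := triples_bounds.
have dN : (k - r <= k.-1)%N by lia.
set f := window_sol F k.-1 (k - r) l.+1.
have fE : chain_poly (fun t => f`_t) l = f.
  apply/polyP => t; rewrite coef_poly; case: ltnP => // lt.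
  by rewrite nth_default // (leq_trans (size_window_sol _ _ _ _)).
split; first by apply/chain_eqP => t tl _; rewrite fE window_solP.
by move=> _; apply: chain_poly_last => t tl; rewrite fE window_solP.
Qed.

Lemma chain_sol_unique (y y' : nat -> F) : (k - r + s + l <= q)%N ->
  chain_sol p q k r s l y -> chain_sol p q k r s l y' ->
  forall t, (t <= l)%N -> y t = y' t.
Proof.
have [rs1 /andP[r0 rk] s0 rp sq] := triples_bounds.
move=> kq [/chain_eqP sol _] [/chain_eqP sol' _] t tl.
have dN : (k - r <= k.-1)%N by lia.
have : chain_poly y l - chain_poly y' l = 0.
  apply: (window_eq0 (M := l.+1) dN) => [|t' tl'].
    by rewrite (leq_trans (size_polyD _ _)) // geq_max size_polyN !size_poly.
  by rewrite mulrBr coefB sol ?sol' ?subrr //; lia.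
move/(congr1 (fun f : {poly F} => f`_t)); rewrite coefB !coef_poly ltnS tl coef0.
by move/eqP; rewrite subr_eq0 => /eqP.
Qed.

End Chain.

(** * Counting the basis *)

Definition ker_count (al be : seq nat) (k : nat) : nat :=
  (\sum_(w <- triples (size al) (size be) k)
     size (let: (r, s, l) := w in unit_positions al be k r s l))%N.

Definition ker_formula (al be : seq nat) (k : nat) : int :=
  let L := (minn (size al) (size be)).+1 in
  \sum_(2 <= r < k.+1) \sum_(0 <= l < L)
     (term al (r + l))%:Z * ((term be (1 + l))%:Z - (term be (2 + k - r + l))%:Z)
  + \sum_(0 <= l < L) (term al (1 + l))%:Z * \sum_(1 <= s < k.+1) (term be (s + l))%:Z.

Definition weyr_formula (al be : seq nat) (k : nat) : int :=
  \sum_(0 <= l < (minn (size al) (size be)).+1)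
    ((term al (1 + l))%:Z * (term be (k + l))%:Z
     + \sum_(2 <= r < k.+1) (term al (r + l))%:Z *
         ((term be (1 + k - r + l))%:Z - (term be (2 + k - r + l))%:Z)).

Lemma size_labels (F : fieldType) a b (lam : 'I_a -> F) (mu : 'I_b -> F) alpha beta k :
  size (labels lam mu alpha beta k) =
  (\sum_(i < a) \sum_(j < b) (lam i == mu j) * ker_count (alpha i) (beta j) k)%N.
Proof.
rewrite /labels size_flatten sumnE /shape -map_comp big_map big_enum_cond /=.
rewrite pair_bigA big_mkcond /=; apply: eq_bigr => -[i j] _ /=.
rewrite andbT inE /=; case: eqP => _; last by rewrite mul0n.
rewrite mul1n size_allpairs_dep sumnE big_map /ker_count.
by apply: eq_bigr => -[[r s] l].
Qed.

Lemma sum_nat_extend (V : nmodType) (f : nat -> V) m n n' : (m <= n <= n')%N ->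
  (forall i, (n <= i < n')%N -> f i = 0) ->
  \sum_(m <= i < n) f i = \sum_(m <= i < n') f i.
Proof.
case/andP=> mn nn' f0; rewrite (big_cat_nat (n := n) mn nn') /=.
by rewrite [X in _ = _ + X]big_nat [X in _ = _ + X]big1 ?addr0.
Qed.

Lemma term_default s l : (size s < l)%N -> term s l = 0%N.
Proof. by case: l => // l; rewrite ltnS /term /= => /(nth_default 0%N). Qed.

Lemma term_le s l l' : nonincr s -> (l <= l')%N -> (term s l' <= term s l)%N.
Proof. by move=> ns ll; apply: nonincr_le => //; lia. Qed.

Section Count.
Variables (al be : seq nat).
Hypothesis beP : nonincr be.
Let p := size al.
Let q := size be.

Let count_term k r s l : int :=
  (term al (r + l))%:Z * ((term be (s + l))%:Z - (term be (1 + k - r + s + l))%:Z).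

Lemma count_term0l k r s l : (p < r + l)%N -> count_term k r s l = 0.
Proof. by move=> h; rewrite /count_term (term_default h) mul0r. Qed.

Lemma count_term0r k r s l : (q < s + l)%N -> count_term k r s l = 0.
Proof.
by move=> h; rewrite /count_term (term_default h)
  (@term_default be (1 + _ - _ + _ + _)) ?subrr ?mulr0 //; lia.
Qed.

Lemma size_unitsE k r s l : (0 < s)%N -> (r <= k)%N ->
  (size (unit_positions al be k r s l))%:Z = count_term k r s l.
Proof.
move=> s0 rk; rewrite /unit_positions size_allpairs !size_iota PoszM /count_term; congr (_ * _).
by rewrite subzn //; apply: term_le => //; lia.
Qed.

Lemma index_iotaE m n : iota m n = index_iota m (m + n).
Proof. by rewrite /index_iota addKn. Qed.

(** The product [count_term] vanishes as soon as a level is out of range, so all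
    ranges may be enlarged to common ones; for r = 1 the sum over s then
    telescopes with step k. *)
Lemma ker_countE k : (0 < k)%N -> (ker_count al be k)%:Z = ker_formula al be k.
Proof.
move=> k0; rewrite /ker_count (big_morph Posz PoszD (erefl (0 : int))) /triples big_cat.
rewrite !big_allpairs_dep /ker_formula -/p -/q.
set L := minn p q; congr (_ + _).
  transitivity (\sum_(2 <= r < k.+1) \sum_(0 <= l < L.+1) count_term k r 1 l); last first.
    rewrite big_nat [RHS]big_nat; apply: eq_bigr => r /andP[r2 rk]; apply: eq_bigr => l _.
    by rewrite /count_term; congr (_ * (_ - Posz (term _ _))); lia.
  rewrite -(sum_nat_extend (n := (2 + (minn p k - 1))%N)); first last.
  - by move=> r rr; rewrite big1 // => l _; apply: count_term0l; lia.
  - by lia.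
  rewrite index_iotaE big_nat [RHS]big_nat; apply: eq_bigr => r rr.
  rewrite -(sum_nat_extend (n := (minn (p - r) (q - 1)).+1)); first last.
  - move=> l ll; case: (ltnP p (r + l)) => pl; first exact: count_term0l.
    by apply: count_term0r; lia.
  - by lia.
  rewrite index_iotaE add0n; apply: eq_bigr => l _; apply: size_unitsE => //; lia.
transitivity (\sum_(1 <= s < q.+1) \sum_(0 <= l < L.+1) count_term k 1 s l).
  rewrite index_iotaE add1n big_nat [RHS]big_nat; apply: eq_bigr => s ss.
  rewrite -(sum_nat_extend (n := (minn (p - 1) (q - s)).+1)); first last.
  - move=> l ll; case: (ltnP p (1 + l)) => pl; first exact: count_term0l.
    by apply: count_term0r; lia.
  - by lia.
  rewrite index_iotaE add0n; apply: eq_bigr => l _; apply: size_unitsE => //; lia.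
rewrite exchange_big /=; apply: eq_bigr => l _; rewrite /count_term -mulr_sumr; congr (_ * _).
rewrite sumrB.
have -> : \sum_(1 <= s < q.+1) (term be (s + l))%:Z =
          \sum_(1 <= s < (q + k).+1) (term be (s + l))%:Z.
  apply: sum_nat_extend => [|s ss]; first by lia.
  by rewrite term_default //; lia.
rewrite (big_cat_nat (n := k.+1)) /=; [|lia..].
rewrite [X in _ + X - _](_ : _ = \sum_(1 <= s < q.+1) (term be (1 + k - 1 + s + l))%:Z).
  by rewrite addrK.
rewrite -[k.+1]add1n big_addn.
rewrite (_ : (q + k).+1 - k = q.+1)%N; last by lia.
by apply: eq_bigr => s _; congr (Posz (term _ _)); lia.
Qed.

Lemma ker_count0 : ker_count al be 0 = 0%N.
Proof.
rewrite /ker_count /triples minn0 [iota 2 _]/= cat0s big_allpairs_dep.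
rewrite big1 // => s _; rewrite big1 // => l _.
by rewrite /unit_positions addn0 subnn add0n subnn allpairs0r.
Qed.

Lemma weyr_formulaE k : (0 < k)%N ->
  (ker_count al be k)%:Z - (ker_count al be k.-1)%:Z = weyr_formula al be k.
Proof.
case: k => // k _ /=; rewrite ker_countE // /weyr_formula.
have -> : (ker_count al be k)%:Z = ker_formula al be k.
  case: k => [|k]; last by rewrite ker_countE.
  rewrite ker_count0 /ker_formula big_geq // add0r big1 // => l _.
  by rewrite big_geq ?mulr0.
rewrite /ker_formula -/p -/q; set L := (minn p q).+1.
rewrite big_split /= [X in _ = _ + X]exchange_big /=.
rewrite opprD addrACA addrC; congr (_ + _).
  rewrite -sumrB; apply: eq_bigr => l _.
  by rewrite -mulrBr big_nat_recr //= [X in X - _]addrC addrK.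
case: k => [|k]; first by rewrite !big_geq // subr0.
rewrite big_nat_recr //= [RHS]big_nat_recr //= addrAC -sumrB; congr (_ + _).
  apply: eq_big_nat => r /andP[r2 rk].
  rewrite -sumrB; apply: eq_bigr => l _; rewrite -mulrBr; congr (_ * _).
  have -> : (2 + k.+2 - r + l = (2 + k.+1 - r + l).+1)%N by lia.
  have -> : (1 + k.+2 - r + l = 2 + k.+1 - r + l)%N by lia.
  by ring.
by apply: eq_bigr => l _; rewrite !addnK.
Qed.

Lemma ker_count_leS k : (ker_count al be k <= ker_count al be k.+1)%N.
Proof.
rewrite -lez_nat -subr_ge0; have := @weyr_formulaE k.+1 isT => /= ->.
apply: sumr_ge0 => l _; rewrite addr_ge0 // big_nat sumr_ge0 // => r rr.
by rewrite mulr_ge0 // subr_ge0 lez_nat; apply: term_le => //; lia.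
Qed.

(** All terms of the difference are nonnegative.  If k < q, the product of al_1 and
    be_(k+1) is positive.  If q <= k < p + q - 1, the term l = 0, r = k + 2 - q is
    positive, since be drops from be_q to 0 there and r <= p.  For larger k every
    product has a factor out of range. *)
Lemma ker_count_ltS k : (0 < p)%N -> (0 < q)%N ->
  (forall h, (h < p)%N -> (0 < nth 0%N al h)%N) ->
  (forall h, (h < q)%N -> (0 < nth 0%N be h)%N) ->
  (ker_count al be k < ker_count al be k.+1)%N = (k < p + q - 1)%N.
Proof.
move=> p0 q0 alp bep.
have ge0 l r : (2 <= r < k.+2)%N -> 0 <= (term al (r + l))%:Z *
         ((term be (1 + k.+1 - r + l))%:Z - (term be (2 + k.+1 - r + l))%:Z).
  by move=> rr; rewrite mulr_ge0 // subr_ge0 lez_nat; apply: term_le => //; lia.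
have sge0 l : 0 <= \sum_(2 <= r < k.+2) (term al (r + l))%:Z *
         ((term be (1 + k.+1 - r + l))%:Z - (term be (2 + k.+1 - r + l))%:Z).
  by rewrite big_nat sumr_ge0 // => r rr; apply: ge0.
rewrite -ltz_nat -subr_gt0; have := @weyr_formulaE k.+1 isT => /= ->.
apply/idP/idP => [|kpq].
  apply: contraTT; rewrite -leqNgt => kpq.
  rewrite -leNgt /weyr_formula big1 // => l _.
  rewrite (@term_default be (k.+1 + l)) ?mulr0 ?add0r; last by rewrite -/q; lia.
  rewrite big_nat big1 // => r rr; case: (ltnP p (r + l)) => pl.
    by rewrite (term_default pl) mul0r.
  by rewrite !(@term_default be) ?subrr ?mulr0 // -/q; lia.
rewrite /weyr_formula big_nat_recl //; apply: ltr_wpDr.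
  by apply: sumr_ge0 => l _; rewrite addr_ge0.
case: (ltnP k q) => kq.
  apply: ltr_wpDr => //; rewrite !addn0 /term /= mulr_gt0 // ltz_nat.
    exact: alp.
  exact: bep.
apply: ltr_wpDl => //; pose r0 := (k.+2 - q)%N.
have r0P : (2 <= r0 < k.+2)%N by rewrite /r0; lia.
rewrite (bigD1_seq r0) ?mem_index_iota ?iota_uniq //=.
apply: ltr_wpDr; first by rewrite big_nat_cond sumr_ge0 // => r /andP[rr _]; apply: ge0.
rewrite (@term_default be (2 + _ - _ + _)) -/q; last by rewrite /r0; lia.
rewrite subr0 mulr_gt0 // ltz_nat /term.
  by apply: alp; rewrite /r0; lia.
by apply: bep; rewrite /r0; lia.
Qed.

Lemma ker_count_eqS k : (0 < p)%N -> (0 < q)%N ->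
  (forall h, (h < p)%N -> (0 < nth 0%N al h)%N) ->
  (forall h, (h < q)%N -> (0 < nth 0%N be h)%N) ->
  (ker_count al be k == ker_count al be k.+1)%N = (p + q - 1 <= k)%N.
Proof.
move=> p0 q0 alp bep; rewrite [RHS]leqNgt -ker_count_ltS //.
by rewrite -leqNgt eqn_leq ker_count_leS.
Qed.

End Count.

(** * Jordan strings and generalised eigenspaces *)

Import passmx.

Section Powers.
Variables (F : fieldType) (V : vectType F).
Implicit Types (f g : 'End(V)) (z : F) (v : V).

Lemma lpowS g k v : lpow g k.+1 v = g (lpow g k v).
Proof. by rewrite /= comp_lfunE. Qed.

Lemma lpowSr g k v : lpow g k.+1 v = lpow g k (g v).
Proof.
by elim: k v => [|k IHk] v; [rewrite lpowS !id_lfunE | rewrite lpowS IHk -lpowS].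
Qed.

Lemma ker_pow_leq g k k' : (k <= k')%N -> (lker (lpow g k) <= lker (lpow g k'))%VS.
Proof.
move=> /subnKC <-; apply/subvP => v; rewrite !memv_ker => /eqP vk.
by elim: (k' - k)%N => [|n IHn]; rewrite ?addn0 ?vk // addnS lpowS (eqP IHn) linear0.
Qed.

Lemma memv_ker_powS g k v : (v \in lker (lpow g k.+1)) = (g v \in lker (lpow g k)).
Proof. by rewrite !memv_ker lpowSr. Qed.

Lemma lker_pow0 g : lker (lpow g 0) = 0%VS.
Proof. by apply/eqP; rewrite -subv0; apply/subvP => v; rewrite memv_ker id_lfunE memv0. Qed.

Lemma kerdim0 f z : kerdim f z 0 = 0%N.
Proof. by rewrite /kerdim lker_pow0 dimv0. Qed.

Lemma kerdim_leq f z k k' : (k <= k')%N -> (kerdim f z k <= kerdim f z k')%N.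
Proof. by move=> kk; apply/dimvS/ker_pow_leq. Qed.

Lemma ker_pow_stable f z q k : kerdim f z q = kerdim f z q.+1 -> (q <= k)%N ->
  lker (lpow (f - z *: \1%VF) k) = lker (lpow (f - z *: \1%VF) q).
Proof.
move=> dq /subnKC <-; elim: (k - q)%N => [|n IHn]; first by rewrite addn0.
apply/vspaceP => v; rewrite addnS memv_ker_powS IHn -memv_ker_powS.
have/eqP-> // : lker (lpow (f - z *: \1%VF) q) == lker (lpow (f - z *: \1%VF) q.+1).
by rewrite eqEdim ker_pow_leq //= -/(kerdim f z q.+1) -dq.
Qed.

Lemma op_indexP f z : [/\ (0 < op_index f z)%N,
   kerdim f z (op_index f z) = kerdim f z (op_index f z).+1 &
   forall k, (0 < k < op_index f z)%N -> (kerdim f z k < kerdim f z k.+1)%N].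
Proof.
rewrite /op_index; case: ex_minnP => q /andP[q0 /eqP eq] min; split=> // k /andP[k0 kq].
rewrite ltn_neqAle kerdim_leS andbT; apply: contraTN kq => ek.
by rewrite -leqNgt min // k0.
Qed.

Lemma kerdim_stable f z k : (op_index f z <= k)%N -> kerdim f z k = kerdim f z (op_index f z).
Proof. by have [_ eq _] := op_indexP f z => qk; rewrite /kerdim (ker_pow_stable eq qk). Qed.

Lemma eigen_kerdim f z : passmx.leigenvalue f z = (0 < kerdim f z 1)%N.
Proof.
rewrite /passmx.leigenvalue /passmx.leigenspace /kerdim lt0n dimv_eq0.
suff -> : lpow (f - z *: \1%VF) 1 = f - z *: \1%VF by [].
by apply/lfunP => v; rewrite lpowS id_lfunE.
Qed.

Lemma op_index_le_dim f z : passmx.leigenvalue f z -> (op_index f z <= \dim {:V})%N.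
Proof.
rewrite eigen_kerdim => e1; have [q0 _ lt] := op_indexP f z.
suff H k : (k <= op_index f z)%N -> (k <= kerdim f z k)%N.
  by apply: leq_trans (H _ (leqnn _)) (dimvS (subvf _)).
elim: k => // -[_ _ //|k] IHk kq.
by apply: leq_ltn_trans (IHk (ltnW kq)) _; apply: lt.
Qed.

Lemma nth_weyr_char f z h :
  nth 0%N (weyr_char f z) h = (kerdim f z h.+1 - kerdim f z h)%N.
Proof.
case: (ltnP h (op_index f z)) => hq; first by rewrite nth_mkseq.
rewrite nth_default ?size_mkseq //.
by rewrite !kerdim_stable ?subnn // (leq_trans hq).
Qed.

Lemma weyr_char_pos f z h : passmx.leigenvalue f z -> (h < size (weyr_char f z))%N ->
  (0 < nth 0%N (weyr_char f z) h)%N.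
Proof.
move=> ez; rewrite size_mkseq nth_weyr_char subn_gt0 => hq.
case: h hq => [|h] hq; first by rewrite kerdim0 -eigen_kerdim.
by have [_ _ ->] := op_indexP f z.
Qed.

Lemma weight_weyr_char f z : weight (weyr_char f z) = kerdim f z (op_index f z).
Proof.
rewrite /weight /block_size -(big_mkord xpredT (fun h => nth 0%N (weyr_char f z) h)).
rewrite size_mkseq; elim: (op_index f z) => [|q IHq]; first by rewrite big_geq // kerdim0.
by rewrite big_nat_recr //= IHq nth_weyr_char subnKC ?kerdim_leS.
Qed.

End Powers.

Section Strings.
Variables (F : fieldType) (V : vectType F) (g : 'End(V)).
Let U k := lker (lpow g k).

(** X is a basis of a complement of U h in U h.+1. *)
Definition level_basis h (X : seq V) : Prop :=
  [/\ \dim <<X>> = size X, (<<X>> :&: U h = 0)%VS & (<<X>> + U h = U h.+1)%VS].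

Lemma level_basis_size h X : level_basis h X -> size X = (\dim (U h.+1) - \dim (U h))%N.
Proof.
by case=> dX cap sum; rewrite -sum dimv_disjoint_sum // dX addnK.
Qed.

(** The operator g embeds U h.+2 / U h.+1 into U h.+1 / U h, so the image of X is
    free modulo U h and extends to a basis of a complement. *)
Lemma level_basis_lower h X : level_basis h.+1 X ->
  exists Y, level_basis h (map g X ++ Y).
Proof.
case=> dX cap sum; pose C := <<map g X>>%VS.
have gC : C = (g @: <<X>>)%VS by rewrite limg_span.
have Xsub : (<<X>> <= U h.+2)%VS by rewrite -sum addvSl.
have dC : \dim C = size X.
  rewrite gC limg_dim_eq //; apply/eqP; rewrite -subv0 -cap; apply: capvS => //.
  apply/subvP => v; rewrite memv_ker => /eqP gv.
  by rewrite (memv_ker_powS g h) gv mem0v.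
have CU : (C :&: U h = 0)%VS.
  apply/eqP; rewrite -subv0; apply/subvP => w; rewrite memv_cap gC => /andP[].
  case/memv_imgP => v vX ->; rewrite -memv_ker_powS => vU.
  have : v \in (<<X>> :&: U h.+1)%VS by rewrite memv_cap vX vU.
  by rewrite cap !memv0 => /eqP->; rewrite linear0.
have CU1 : (C + U h <= U h.+1)%VS.
  rewrite subv_add ker_pow_leq // andbT gC; apply/subvP => w /memv_imgP[v vX ->].
  by rewrite -memv_ker_powS; apply: (subvP Xsub).
pose D := (U h.+1 :\: (C + U h))%VS; exists (vbasis D).
have Dcap : (D :&: (C + U h) = 0)%VS := capv_diff _ _.
have spanE : <<map g X ++ vbasis D>>%VS = (C + D)%VS.
  by rewrite span_cat (span_basis (vbasisP D)).
have sumAC : (C + D + U h = D + (C + U h))%VS by rewrite [(C + D)%VS]addvC addvA.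
have sumE : (C + D + U h = U h.+1)%VS.
  by rewrite sumAC addv_diff; apply/addv_idPl.
have dE : (\dim (C + D + U h) = \dim C + \dim D + \dim (U h))%N.
  rewrite sumAC dimv_disjoint_sum // dimv_disjoint_sum //.
  by rewrite addnA [(\dim D + _)%N]addnC.
have dCD : (\dim (C + D) = \dim C + \dim D)%N.
  apply/eqP; rewrite eqn_leq (dimv_add_leqif C D) /= -(leq_add2r (\dim (U h))) -dE.
  exact: (dimv_add_leqif _ _).
split; rewrite spanE //.
  by rewrite size_cat size_map size_tuple dCD dC.
apply/eqP; rewrite -dimv_eq0 -(eqn_add2l (\dim (C + D + U h))) addn0.
by rewrite dimv_sum_cap dCD dE.
Qed.

Lemma level_basis_top h : exists X, level_basis h X.
Proof.
pose D := (U h.+1 :\: U h)%VS; exists (vbasis D).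
rewrite /level_basis (span_basis (vbasisP D)) size_tuple; split=> //.
  exact: capv_diff.
by rewrite addv_diff; apply/addv_idPl/ker_pow_leq.
Qed.

(** Built from the top level down.  The images come first in each level, so g
    sends the vector of rank u to the vector of rank u of the level below. *)
Lemma jordan_levels q : exists bs : nat -> seq V,
  (forall h, (h < q)%N -> level_basis h (bs h)) /\
  (forall h, (h.+1 < q)%N -> exists Y, bs h = map g (bs h.+1) ++ Y).
Proof.
suff H j : (j <= q)%N -> exists bs : nat -> seq V,
  (forall h, (q - j <= h < q)%N -> level_basis h (bs h)) /\
  (forall h, (q - j <= h)%N -> (h.+1 < q)%N -> exists Y, bs h = map g (bs h.+1) ++ Y).
  have [bs [b1 b2]] := H q (leqnn q); exists bs; rewrite subnn in b1 b2.
  by split=> [h hq|h hq]; [apply: b1 | apply: b2].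
elim: j => [|j IHj] jq.
  by exists (fun=> [::]); split=> h; rewrite subn0; [move=> /andP[]|]; lia.
have [bs [b1 b2]] := IHj (ltnW jq).
have [X [lX X2]] : exists X, level_basis (q - j.+1) X /\
    ((q - j < q)%N -> exists Y, X = map g (bs (q - j)%N) ++ Y).
  case: (posnP j) => [->|j0].
    have [X lX] := level_basis_top (q - 1); exists X; split=> //.
    by rewrite subn0 ltnn.
  have lt : (q - j < q)%N by lia.
  have := b1 (q - j)%N; rewrite leqnn lt => /(_ isT).
  have -> : (q - j = (q - j.+1).+1)%N by lia.
  by case/level_basis_lower => Y lY; exists (map g (bs (q - j.+1).+1) ++ Y); split=> // _; exists Y.
exists (fun h => if h == (q - j.+1)%N then X else bs h); split=> [h hq|h h1 h2].
  by case: eqP => [-> //|ne]; apply: b1; lia.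
have -> : (h.+1 == q - j.+1)%N = false by lia.
case: eqP => [e|ne]; last by apply: b2; lia.
have -> : h.+1 = (q - j)%N by lia.
by apply: X2; lia.
Qed.

End Strings.

Section WeyrForm.
Variables (F : fieldType) (V : vectType F) (f : 'End(V)).

Lemma weyr_char_nonincr z : nonincr (weyr_char f z).
Proof.
move=> h; rewrite !nth_weyr_char.
have [bs [b1 b2]] := jordan_levels (f - z *: \1%VF) h.+2.
have := level_basis_size (b1 h.+1 (ltnSn _)); rewrite -!/(kerdim f z _) => <-.
have := level_basis_size (b1 h (ltnW (ltnSn _))); rewrite -!/(kerdim f z _) => <-.
by have [Y ->] := b2 h (ltnSn _); rewrite size_cat size_map leq_addr.
Qed.

Local Notation e := (vbasis {:V}).
Let eP : basis_of {:V} e := vbasisP _.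
Let A := passmx.mxof e e f.

Lemma kermxpoly_XsubC n (M : 'M[F]_n) z k :
  kermxpoly M (('X - z%:P) ^+ k) = kermx ((M - z%:M) ^+ k).
Proof.
case: n M => [|n] M; first by rewrite !thinmx0.
by rewrite /kermxpoly rmorphXn /= rmorphB /= horner_mx_X horner_mx_C.
Qed.

Lemma memv_ker_mx z k v : (v \in lker (lpow (f - z *: \1%VF) k)) =
  (passmx.rVof e v <= kermxpoly A (('X - z%:P) ^+ k))%MS.
Proof.
rewrite kermxpoly_XsubC (sameP sub_kermxP eqP) memv_ker.
suff <- : passmx.rVof e (lpow (f - z *: \1%VF) k v) = passmx.rVof e v *m (A - z%:M) ^+ k.
  by rewrite (passmx.rVof_eq0 eP).
elim: k v => [|k IHk] v; first by rewrite id_lfunE expr0 mulmx1.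
rewrite lpowSr IHk exprS mulmxA; congr (_ *m _).
rewrite add_lfunE opp_lfunE scale_lfunE id_lfunE addrC -scaleNr.
rewrite passmx.rVof_linear (passmx.rVof_app _ eP) mulmxBr mul_mx_scalar.
by rewrite scaleNr addrC.
Qed.

Variables (a : nat) (lam : 'I_a -> F).
Hypothesis lam_inj : injective lam.

(** The kernels are those of the pairwise coprime polynomials (X - lam i)^(q i)
    in the matrix of f. *)
Lemma gen_eigenspaces_direct (q : 'I_a -> nat) :
  directv (\sum_i lker (lpow (f - lam i *: \1%VF) (q i)))%VS.
Proof.
apply/directv_sum_independent => us usP us0 i _.
have cop : {in xpredT &, forall j j', j' != j ->
    coprimep (('X - (lam j)%:P) ^+ q j) (('X - (lam j')%:P) ^+ q j')}.
  move=> j j' _ _ ne; rewrite coprimep_expl // coprimep_expr // coprimep_XsubC.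
  by rewrite root_XsubC (inj_eq lam_inj).
have /mxdirect_sumsP /(_ i isT) cap := mxdirect_sum_kermx A cop.
apply/eqP; rewrite -(passmx.rVof_eq0 eP) -submx0 -cap sub_capmx -memv_ker_mx usP //=.
have /(congr1 (passmx.rVof e)) : us i = - \sum_(j | j != i) us j.
  by apply/eqP; rewrite -addr_eq0; apply/eqP; rewrite -[RHS]us0 [RHS](bigD1 i).
rewrite linearN linear_sum /= => ->; rewrite -scaleN1r scalemx_sub // summx_sub // => j ji.
by rewrite (sumsmx_sup j) // -memv_ker_mx usP.
Qed.

End WeyrForm.

(** * Weyr canonical form of an operator *)

Section WeyrIso.
Variables (F : fieldType) (V : vectType F) (f : 'End(V)).
Variables (a : nat) (lam : 'I_a -> F) (alpha : 'I_a -> seq nat).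
Hypotheses (lam_inj : injective lam) (alphaE : forall i, alpha i = weyr_char f (lam i)).
Local Notation N := (\sum_i weight (alpha i))%N.

Lemma weights_leq_dim : (N <= \dim {:V})%N.
Proof.
under eq_bigr => i _ do rewrite alphaE weight_weyr_char.
have /directvP /= <- := gen_eigenspaces_direct f lam_inj (fun i => op_index f (lam i)).
exact: (dimvS (subvf _)).
Qed.

(** The unit vector at position (i, h, u) is sent to the vector of rank u and level
    h of the strings for lam i.  Asking for the dimension, rather than for the
    lam i to be all the eigenvalues, allows a use for operators known only through
    the dimensions of their kernels. *)
Lemma weyr_iso : N = \dim {:V} ->
  exists h : 'Hom('cV[F]_N, V), [/\ lker h == 0%VS, limg h = fullv
    & forall c, f (h c) = h (weyr_form lam alpha *m c)].
Proof.
move=> dimN.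
pose q i := op_index f (lam i).
pose g i := f - lam i *: \1%VF.
have full : (\sum_i lker (lpow (g i) (q i)))%VS = fullv.
  apply/eqP; rewrite eqEdim subvf /=.
  have /directvP /= -> := gen_eigenspaces_direct f lam_inj (fun i => op_index f (lam i)).
  rewrite -dimN; apply: leq_sum => i _.
  by rewrite alphaE weight_weyr_char.
rewrite weyr_form_coords.
move: (@weyr_pos a alpha) (weyr_pos_coords alpha) dimN.
move: (\sum_i weight (alpha i))%N => n pos posP dimN.
have [bs bsP] := fin_all_exists (fun i => jordan_levels (g i) (q i)).
have sz i : size (alpha i) = q i by rewrite alphaE size_mkseq.
have szb i h : (h < q i)%N -> size (bs i h) = nth 0%N (alpha i) h.
  move=> hq; have [/(_ h hq) /level_basis_size -> _] := bsP i.
  by rewrite alphaE nth_weyr_char.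
pose B (p : 'I_a * nat * nat) := nth 0 (bs p.1.1 p.1.2) p.2.
have validq i h u : valid_pos alpha (i, h, u) -> (h < q i)%N.
  rewrite /valid_pos /= => vu; rewrite ltnNge; apply/negP => le.
  by move: vu; rewrite nth_default ?ltn0 ?sz.
have gB0 i u : valid_pos alpha (i, 0%N, u) -> g i (B (i, 0%N, u)) = 0.
  move=> vu; have hq := validq _ _ _ vu; have [/(_ _ hq) [_ _ sum] _] := bsP i.
  apply/eqP; rewrite -memv0 -(lker_pow0 (g i)) -memv_ker_powS -sum.
  by apply: (subvP (addvSl _ _)); apply: memv_span; rewrite mem_nth // szb.
have gBS i h u : valid_pos alpha (i, h.+1, u) -> g i (B (i, h.+1, u)) = B (i, h, u).
  move=> vu; have hq := validq _ _ _ vu; have [_ /(_ _ hq) [Y bE]] := bsP i.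
  have us : (u < size (bs i h.+1))%N by rewrite szb.
  by rewrite /B /= bE nth_cat size_map us (nth_map 0).
pose b (x : 'I_n) := B (pos x).
pose hh (c : 'cV[F]_n) := \sum_x c x 0 *: b x.
have linh : linear hh.
  move=> t c d; rewrite /hh scaler_sumr -big_split; apply: eq_bigr => x _ /=.
  by rewrite !mxE scalerDl scalerA.
pose lT := GRing.isLinear.Build _ _ _ _ _ linh.
pose hl : {linear _ -> _} := HB.pack hh lT.
have hE c : linfun hl c = hh c by rewrite lfunE.
have fb y : f (b y) = lam (pos y).1.1 *: b y
    + \sum_x (pos y == ((pos x).1.1, (pos x).1.2.+1, (pos x).2))%:R *: b x.
  have vy : valid_pos alpha (pos y) by apply/(proj2 posP); exists y.
  rewrite -[f (b y)](subrK (lam (pos y).1.1 *: b y)) addrC; congr (_ + _).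
  transitivity (g (pos y).1.1 (b y)).
    by rewrite /g add_lfunE opp_lfunE scale_lfunE id_lfunE.
  rewrite /b; case: (pos y) vy => [[i [|h]] u] vy /=.
    rewrite gB0 // big1 // => x _; by case: eqP => [//|]; rewrite scale0r.
  rewrite gBS //.
  have vx : valid_pos alpha (i, h, u).
    apply: valid_down vy => // j; rewrite alphaE; exact: weyr_char_nonincr.
  have [x px] := proj2 (proj2 posP _) vx.
  rewrite (bigD1 x) //= px eqxx scale1r big1 ?addr0 // => x' xx'.
  case: eqP => [[e1 e2 e3]|]; last by rewrite scale0r.
  case/eqP: xx'; apply: (proj1 posP); rewrite px e1 e2 e3.
  by case: (pos x') => [[]].
have lim : limg (linfun hl) = fullv.
  apply/eqP; rewrite eqEsubv subvf /= -full; apply/subv_sumP => i _.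
  have bl h u : (h < q i)%N -> (u < size (bs i h))%N -> nth 0 (bs i h) u \in limg (linfun hl).
    move=> hq; rewrite szb // => vu.
    have [x px] := proj2 (proj2 posP (i, h, u)) vu.
    have -> : nth 0 (bs i h) u = linfun hl (delta_mx x 0).
      rewrite hE /hh (bigD1 x) //= mxE !eqxx scale1r /b px big1 ?addr0 // => y yx.
      by rewrite mxE (negPf yx) scale0r.
    by apply: memv_img; apply: memvf.
  have : forall k, (k <= q i)%N -> (lker (lpow (g i) k) <= limg (linfun hl))%VS; last exact.
  elim=> [|k IHk] kq; first by rewrite lker_pow0 sub0v.
  have [/(_ k kq) [_ _ <-] _] := bsP i; rewrite subv_add IHk ?(ltnW kq) // andbT.
  apply/span_subvP => v vb; rewrite -(nth_index 0 vb); apply: bl => //.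
  by rewrite index_mem.
exists (linfun hl); split=> // [|c].
  have := limg_ker_dim (linfun hl) fullv; rewrite lim capfv -dimN dimvf /dim /= mulnC mul1n.
  by move=> dd; rewrite -dimv_eq0 -(eqn_add2r n) add0n; apply/eqP.
rewrite !hE /hh linear_sum.
pose D x y : F := (pos y == ((pos x).1.1, (pos x).1.2.+1, (pos x).2))%:R.
transitivity (\sum_y (c y 0 *: (lam (pos y).1.1 *: b y) + \sum_x c y 0 *: (D x y *: b x))).
  by apply: eq_bigr => y _; rewrite linearZ /= fb scalerDr scaler_sumr.
transitivity (\sum_x ((\sum_y ((x == y)%:R * lam (pos x).1.1) * c y 0) *: b x
                       + (\sum_y D x y * c y 0) *: b x)); last first.
  apply: eq_bigr => x _; rewrite -scalerDl -big_split mxE; congr (_ *: _).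
  by apply: eq_bigr => y _; rewrite mxE mulrDl.
rewrite !big_split /=; congr (_ + _).
  apply: eq_bigr => x _; rewrite (bigD1 x) //= eqxx mul1r big1 ?addr0.
    by rewrite scalerA mulrC.
  by move=> y yx; rewrite eq_sym (negPf yx) !mul0r.
rewrite exchange_big /=; apply: eq_bigr => x _; rewrite scaler_suml.
by apply: eq_bigr => y _; rewrite scalerA mulrC.
Qed.

End WeyrIso.

Section Full.
Variables (F : closedFieldType) (V : vectType F) (f : 'End(V)).
Variables (a : nat) (lam : 'I_a -> F) (alpha : 'I_a -> seq nat).
Hypotheses (lam_inj : injective lam) (alphaE : forall i, alpha i = weyr_char f (lam i)).
Hypothesis lamP : forall z, passmx.leigenvalue f z -> exists i, z = lam i.

(** All roots of the characteristic polynomial are among the lam i, so it divides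
    the product, and Cayley-Hamilton applies. *)
Lemma kermxpoly_full n (M : 'M[F]_n) : (forall z, eigenvalue M z -> exists i, z = lam i) ->
  (kermxpoly M (\prod_i ('X - (lam i)%:P) ^+ n) :=: 1%:M)%MS.
Proof.
case: n M => [|n] M eigM; first by rewrite !thinmx0.
apply: kermxpoly_min; apply: dvdp_trans (mxminpoly_dvd_char M) _.
have [rs cE] := closed_field_poly_normal (char_poly M).
move: (char_poly_monic M) => /monicP lc; rewrite lc scale1r in cE.
have srs : size rs = n.+1.
  by have := size_char_poly M; rewrite cE size_prod_XsubC => -[].
have rsP z : z \in rs -> exists i, z = lam i.
  by move=> zr; apply: eigM; rewrite eigenvalue_root_char cE root_prod_XsubC.
rewrite cE prodrXl -srs; elim: rs rsP {cE srs lc} => [|z rs IH] rsP.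
  by rewrite big_nil dvd1p.
rewrite big_cons exprS dvdp_mul // ?IH // => [|w wrs]; last first.
  by apply: rsP; rewrite inE wrs orbT.
have [i ->] := rsP z (mem_head _ _).
by rewrite (bigD1 i) //= dvdp_mulIl.
Qed.

Lemma weights_full : (\sum_i weight (alpha i))%N = \dim {:V}.
Proof.
apply/eqP; rewrite eqn_leq (weights_leq_dim lam_inj alphaE) /=.
under eq_bigr => i _ do rewrite alphaE weight_weyr_char.
set n := \dim {:V}.
apply: (@leq_trans (\dim (\sum_i lker (lpow (f - lam i *: \1%VF) n))%VS)); last first.
  apply: leq_trans (dimv_leq_sum _ _ _) _; apply: leq_sum => i _.
  rewrite -/(kerdim f (lam i) n); case: (leqP n (op_index f (lam i))) => le.
    exact: kerdim_leq.
  by rewrite kerdim_stable // ltnW.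
apply: dimvS; apply/subvP => v _.
pose e := vbasis {:V}; have eP : basis_of {:V} e := vbasisP _.
pose A := passmx.mxof e e f.
have cop : {in xpredT &, forall j j' : 'I_a, j' != j ->
    coprimep (('X - (lam j)%:P) ^+ n) (('X - (lam j')%:P) ^+ n)}.
  move=> j j' _ _ ne; rewrite coprimep_expl // coprimep_expr // coprimep_XsubC.
  by rewrite root_XsubC (inj_eq lam_inj).
have eigA z : eigenvalue A z -> exists i, z = lam i.
  move=> ez; apply: lamP; rewrite /leigenvalue (leigenspaceE eP).
  by rewrite (vsof_eq0 eP).
have : (rVof e v <= \sum_i kermxpoly A (('X - (lam i)%:P) ^+ n))%MS.
  by rewrite -(kermxpoly_prod A cop) (kermxpoly_full eigA) submx1.
case/sub_sumsmxP => u vE; rewrite -(rVofK eP v) vE linear_sum.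
apply: memv_sumr => i _; rewrite memv_ker_mx.
by rewrite (vecofK eP) submxMl.
Qed.

End Full.

(** * Transport along similarity *)

Section Transport.
Variable F : fieldType.

Lemma kerdim_iso (V W : vectType F) (f : 'End(V)) (g : 'End(W)) (h : 'Hom(W, V)) z k :
  lker h == 0%VS -> limg h = fullv -> (forall w, f (h w) = h (g w)) ->
  kerdim f z k = kerdim g z k.
Proof.
move=> h0 hf fh.
have pw w : lpow (f - z *: \1%VF) k (h w) = h (lpow (g - z *: \1%VF) k w).
  elim: k => [|k IHk]; first by rewrite !id_lfunE.
  rewrite !lpowS IHk; move: (lpow _ k w) => u.
  rewrite !add_lfunE !opp_lfunE !scale_lfunE !id_lfunE fh [RHS]linearB.
  by congr (_ - _); rewrite linearZ.
rewrite /kerdim -(limg_dim_eq (f := h) (U := lker (lpow (g - z *: \1%VF) k))); last first.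
  by rewrite (eqP h0) capv0.
congr (\dim _); apply/vspaceP => v; apply/idP/memv_imgP => [|[w wk ->]]; last first.
  by move: wk; rewrite !memv_ker pw => /eqP->; rewrite linear0.
have /memv_imgP [w _ ->] : v \in limg h by rewrite hf memvf.
rewrite memv_ker pw => /eqP hw; exists w => //; rewrite memv_ker.
by apply/eqP; apply: (lker0P h0); rewrite hw linear0.
Qed.

Lemma sylv_shift m n (A : 'M[F]_m) (B : 'M[F]_n) z :
  sylv A B - z *: \1%VF = sylv (A - z%:M) B.
Proof.
apply/lfunP => X; rewrite add_lfunE opp_lfunE scale_lfunE id_lfunE !sylvE.
by rewrite mulmxBl mul_scalar_mx addrAC.
Qed.

Lemma kerdim_sylv0 m n (A : 'M[F]_m) (B : 'M[F]_n) k :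
  \dim (lker (lpow (sylv A B) k)) = kerdim (sylv A B) 0 k.
Proof. by rewrite /kerdim scale0r subr0. Qed.

Lemma mxopE m (A : 'M[F]_m) v : mxop A v = A *m v.
Proof. exact: lfunE. Qed.

Definition hom_mx m n (h : 'Hom('cV[F]_n, 'cV[F]_m)) : 'M[F]_(m, n) :=
  \matrix_(i, j) h (delta_mx j 0) i 0.

Lemma hom_mxE m n (h : 'Hom('cV[F]_n, 'cV[F]_m)) c : hom_mx h *m c = h c.
Proof.
apply/colP => i; rewrite mxE; have -> : c = \sum_j c j 0 *: delta_mx j 0.
  apply/colP => j; rewrite summxE (bigD1 j) //= !mxE !eqxx mulr1 big1 ?addr0 // => j' ne.
  by rewrite !mxE eq_sym (negPf ne) mulr0.
rewrite linear_sum summxE; apply: eq_bigr => j _.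
rewrite linearZ /= !mxE summxE (bigD1 j) //= !mxE !eqxx mulr1 big1 ?addr0 1?mulrC // => j' ne.
by rewrite !mxE eq_sym (negPf ne) mulr0.
Qed.

Lemma mulmx_colP m n (A B : 'M[F]_(m, n)) : (forall c : 'cV_n, A *m c = B *m c) -> A = B.
Proof.
move=> eqAB; apply/matrixP => i j; have := congr1 (fun c : 'cV_m => c i 0) (eqAB (delta_mx j 0)).
by rewrite -!colE !mxE.
Qed.

(** The two sizes are equal without being convertible: one is a sum of weights. *)
Definition mx_similar m N (A : 'M[F]_m) (W : 'M[F]_N) : Prop :=
  exists P : 'M[F]_(m, N), exists P' : 'M[F]_(N, m),
    [/\ P *m P' = 1%:M, P' *m P = 1%:M & A *m P = P *m W].

Lemma hom_similar m N (A : 'M[F]_m) (W : 'M[F]_N) (h : 'Hom('cV[F]_N, 'cV[F]_m)) :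
  lker h == 0%VS -> limg h = fullv -> (forall c, mxop A (h c) = h (W *m c)) ->
  mx_similar A W.
Proof.
move=> h0 hf hA; exists (hom_mx h), (hom_mx h^-1%VF); split; apply: mulmx_colP => c.
- by rewrite -mulmxA !hom_mxE mul1mx limg_lfunVK // hf memvf.
- by rewrite -mulmxA !hom_mxE mul1mx lker0_lfunK.
- by rewrite -!mulmxA !hom_mxE -mxopE hA.
Qed.

Lemma kerdim_sylv_similar m n M N (A : 'M[F]_m) (B : 'M[F]_n) (WA : 'M[F]_M) (WB : 'M[F]_N) z k :
  mx_similar A WA -> mx_similar B WB ->
  kerdim (sylv A B) z k = kerdim (sylv WA WB) z k.
Proof.
move=> [P [P' [PP PP' AP]]] [Q [Q' [QQ QQ' BQ]]].
pose h : 'Hom('M[F]_(M, N), 'M[F]_(m, n)) := linfun (mulmxr Q' \o mulmx P).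
have hE X : h X = P *m X *m Q' by rewrite /h lfunE.
apply: (kerdim_iso (h := h)).
- apply/lker0P => X Y; rewrite !hE => /(congr1 (fun Z => P' *m Z *m Q)).
  by rewrite !mulmxA PP' !mul1mx -!mulmxA QQ' !mulmx1.
- apply/vspaceP => X; rewrite memvf; apply/memv_imgP; exists (P' *m X *m Q); first exact: memvf.
  by rewrite hE !mulmxA PP mul1mx -!mulmxA QQ mulmx1.
- have QB : Q' *m B = WB *m Q'.
    by rewrite -[LHS]mulmx1 -QQ mulmxA -[Q' *m B *m Q]mulmxA BQ mulmxA QQ' mul1mx.
  move=> X; rewrite !hE !sylvE mulmxBr mulmxBl !mulmxA AP; congr (_ - _).
  by rewrite -!mulmxA QB.
Qed.

End Transport.

Section KerdimWeyr.
Variables (F : numFieldType) (a b : nat) (lam : 'I_a -> F) (mu : 'I_b -> F).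
Variables (alpha : 'I_a -> seq nat) (beta : 'I_b -> seq nat).
Variables (M N : nat) (posA : 'I_M -> 'I_a * nat * nat) (posB : 'I_N -> 'I_b * nat * nat).
Hypotheses (posAP : weyr_coords alpha posA) (posBP : weyr_coords beta posB).
Hypotheses (alphaP : forall i, nonincr (alpha i)) (betaP : forall j, nonincr (beta j)).
Hypotheses (alpha_gt0 : forall i, (0 < size (alpha i))%N).
Hypotheses (beta_gt0 : forall j, (0 < size (beta j))%N).

Lemma weyr_mx_shift z : weyr_mx lam posA - z%:M = weyr_mx (fun i => lam i - z) posA.
Proof. by apply/matrixP => x y; rewrite !mxE !mulr_natl mulrnBl addrAC. Qed.

Lemma kerdim_weyr_mx z k :
  kerdim (sylv (weyr_mx lam posA) (weyr_mx mu posB)) z k =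
  (\sum_(i < a) \sum_(j < b) (lam i - z == mu j)%R * ker_count (alpha i) (beta j) k)%N.
Proof.
case: (posnP k) => [->|k0].
  rewrite kerdim0 big1 // => i _; rewrite big1 // => j _.
  by rewrite ker_count0 muln0.
pose x (i : 'I_a) (j : 'I_b) (r s l t : nat) : F := (window_sol F k.-1 (k - r) l.+1)`_t.
have xP i j r s l : lam i - z = mu j ->
    (r, s, l) \in triples (size (alpha i)) (size (beta j)) k ->
    poly_sol k (size (beta j)) r s l (x i j r s l).
  move=> _ T; apply: (chain_sol_poly (alpha_gt0 i) (beta_gt0 j) k0 T).
  exact: chain_sol_window.
have bas := label_basis posAP posBP alphaP betaP k0 xP.
rewrite /kerdim sylv_shift weyr_mx_shift -(size_labels (fun i => lam i - z)).
by rewrite (size_basis (X := in_tuple _) bas) size_map.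
Qed.

End KerdimWeyr.

Section OpSimilar.
Variables (F : closedFieldType) (V : vectType F).
Implicit Types f g : 'End(V).

Lemma eigenvalues_enum f : exists a (lam : 'I_a -> F),
  injective lam /\ forall z, leigenvalue f z <-> exists i, z = lam i.
Proof.
pose e := vbasis {:V}; have eP : basis_of {:V} e := vbasisP _.
have [rs cE] := closed_field_poly_normal (char_poly (mxof e e f)).
have eig z : leigenvalue f z = (z \in undup rs).
  rewrite /leigenvalue (leigenspaceE eP) (vsof_eq0 eP) -/(eigenvalue _ _).
  rewrite eigenvalue_root_char cE rootZ ?root_prod_XsubC ?mem_undup //.
  by rewrite lead_coef_eq0 monic_neq0 // char_poly_monic.
exists (size (undup rs)), (fun i => (undup rs)`_i); split=> [i j /eqP|z].
  by rewrite nth_uniq ?undup_uniq // => /eqP /val_inj.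
rewrite eig; split=> [zrs|[i ->]]; last by rewrite mem_nth.
have zi : (index z (undup rs) < size (undup rs))%N by rewrite index_mem.
by exists (Ordinal zi); rewrite /= nth_index.
Qed.

Lemma eq_weyr_char f g z : (forall k, kerdim f z k = kerdim g z k) ->
  weyr_char f z = weyr_char g z.
Proof.
move=> eqk; have eqi : op_index f z = op_index g z.
  by apply: eq_ex_minn => q; rewrite !eqk.
rewrite /weyr_char eqi; apply/eq_in_map => h _.
by rewrite /weyr_num !eqk.
Qed.

(** The kernel dimensions at the eigenvalues of f determine the same Weyr
    characteristics for f and g; their weights add up to the dimension of V, so
    g has no other eigenvalue and the same Weyr form as f. *)
Lemma op_similar_kerdim f g :
  (forall z, leigenvalue f z -> forall k, (1 <= k <= \dim {:V})%N -> kerdim f z k = kerdim g z k) ->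
  op_similar f g.
Proof.
move=> eqd.
have eqk z k : leigenvalue f z -> kerdim f z k = kerdim g z k.
  move=> ez; case: (posnP k) => [->|k0]; first by rewrite !kerdim0.
  case: (leqP k (\dim {:V})) => kd; first by apply: eqd => //; rewrite k0.
  have qf := op_index_le_dim ez.
  have d0 : (0 < \dim {:V})%N by have [q0 _ _] := op_indexP f z; apply: leq_trans qf.
  have eg : leigenvalue g z by rewrite eigen_kerdim -eqd ?d0 // -eigen_kerdim.
  have qg := op_index_le_dim eg.
  rewrite (kerdim_stable (leq_trans qf (ltnW kd))) (kerdim_stable (leq_trans qg (ltnW kd))).
  by rewrite -(kerdim_stable qf) -(kerdim_stable qg) eqd // d0 leqnn.
have [a [lam [lam_inj lamP]]] := eigenvalues_enum f.
pose alpha i := weyr_char f (lam i).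
have alphag i : alpha i = weyr_char g (lam i).
  by apply: eq_weyr_char => k; apply: eqk; apply/lamP; exists i.
have dimN : (\sum_i weight (alpha i))%N = \dim {:V}.
  by apply: (weights_full (f := f) lam_inj) => // z /lamP.
have [h [h0 hf hE]] := weyr_iso (f := f) lam_inj (fun i => erefl) dimN.
have [h' [h0' hf' hE']] := weyr_iso (f := g) lam_inj alphag dimN.
exists (h \o h'^-1)%VF, (h' \o h^-1)%VF.
have surj (u : 'Hom('cV[F]_(\sum_i weight (alpha i)), V)) v : limg u = fullv -> exists c, v = u c.
  by move=> uf; have /memv_imgP [c _ ->] : v \in limg u; [rewrite uf memvf | exists c].
split; apply/lfunP => v.
- have [c ->] := surj h v hf; rewrite !comp_lfunE id_lfunE.
  by rewrite (lker0_lfunK h0) (lker0_lfunK h0').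
- have [c ->] := surj h' v hf'; rewrite !comp_lfunE id_lfunE.
  by rewrite (lker0_lfunK h0') (lker0_lfunK h0).
- have [c ->] := surj h' v hf'; rewrite !comp_lfunE.
  by rewrite (lker0_lfunK h0') hE (lker0_lfunK h0) hE'.
Qed.

Lemma similar_kerdim f g z k : op_similar f g -> kerdim f z k = kerdim g z k.
Proof.
case=> th [thi [e1 e2 ->]]; apply: (kerdim_iso (h := th)).
- apply/lker0P => u v /(congr1 thi); rewrite -!comp_lfunE e2 !id_lfunE //.
- apply/vspaceP => v; rewrite memvf; apply/memv_imgP; exists (thi v); first exact: memvf.
  by rewrite -comp_lfunE e1 id_lfunE.
- by move=> w; rewrite !comp_lfunE -[th (thi _)]comp_lfunE e1 id_lfunE.
Qed.

End OpSimilar.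

Section KernelDimensions.
Variables (F : numClosedFieldType) (m n : nat) (A : 'M[F]_m) (B : 'M[F]_n).
Variables (a b : nat) (lam : 'I_a -> F) (mu : 'I_b -> F).
Hypotheses (lam_inj : injective lam) (mu_inj : injective mu).
Hypothesis lamP : forall z : F, leigenvalue (mxop A) z <-> exists i, z = lam i.
Hypothesis muP : forall z : F, leigenvalue (mxop B) z <-> exists j, z = mu j.
Variables (alpha : 'I_a -> seq nat) (beta : 'I_b -> seq nat).
Hypothesis alphaE : forall i, alpha i = weyr_char (mxop A) (lam i).
Hypothesis betaE : forall j, beta j = weyr_char (mxop B) (mu j).

Lemma kerdim_sylv_weyr z k : kerdim (sylv A B) z k =
  (\sum_(i < a) \sum_(j < b) (lam i - z == mu j)%R * ker_count (alpha i) (beta j) k)%N.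
Proof.
have alphaP i : nonincr (alpha i) by rewrite alphaE; apply: weyr_char_nonincr.
have betaP j : nonincr (beta j) by rewrite betaE; apply: weyr_char_nonincr.
have sal i : (0 < size (alpha i))%N.
  by rewrite alphaE size_mkseq; have [] := op_indexP (mxop A) (lam i).
have sbe j : (0 < size (beta j))%N.
  by rewrite betaE size_mkseq; have [] := op_indexP (mxop B) (mu j).
have dA := weights_full lam_inj alphaE (fun z => proj1 (lamP z)).
have dB := weights_full mu_inj betaE (fun z => proj1 (muP z)).
have [h [h0 hf hE]] := weyr_iso lam_inj alphaE dA.
have [h' [h0' hf' hE']] := weyr_iso mu_inj betaE dB.
rewrite (kerdim_sylv_similar _ _ (hom_similar h0 hf hE) (hom_similar h0' hf' hE')).
rewrite !weyr_form_coords.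
exact: (kerdim_weyr_mx _ _ (weyr_pos_coords alpha) (weyr_pos_coords beta)).
Qed.

End KernelDimensions.

(** * Kernels, eigenvalues and similarity of the Sylvester operator *)

Lemma dim_ker_nilp (F : numFieldType) (al be : seq nat) k :
  nonincr al -> nonincr be -> (0 < size al)%N -> (0 < size be)%N ->
  \dim (lker (lpow (sylv (nilp_weyr F al) (nilp_weyr F be)) k)) = ker_count al be k.
Proof.
move=> alP beP al0 be0; rewrite kerdim_sylv0 !nilp_weyr_coords.
rewrite (kerdim_weyr_mx _ _ (nilp_pos_coords al) (nilp_pos_coords be)) //.
by rewrite !big_ord1 subr0 eqxx mul1n.
Qed.

Lemma sylv_similarP (F : closedFieldType) m n (A C : 'M[F]_m) (B D : 'M[F]_n) :
  op_similar (sylv A B) (sylv C D) <->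
  (forall z, leigenvalue (sylv A B) z -> forall k, (1 <= k <= m * n)%N ->
     \dim (lker (lpow (sylv (A - z%:M) B) k)) = \dim (lker (lpow (sylv (C - z%:M) D) k))).
Proof.
have shift (A' : 'M[F]_m) (B' : 'M[F]_n) z k :
    \dim (lker (lpow (sylv (A' - z%:M) B') k)) = kerdim (sylv A' B') z k.
  by rewrite /kerdim sylv_shift.
split=> [sim z _ k _|eqd].
  rewrite (shift A) (shift C); exact: similar_kerdim.
apply: op_similar_kerdim => z ez k; rewrite dimvf dim_matrix => kmn.
by rewrite -(shift A) -(shift C); apply: eqd.
Qed.

Section SylvesterOperator.
Variables (F : numClosedFieldType) (m n : nat) (A : 'M[F]_m) (B : 'M[F]_n).
Variables (a b : nat) (lam : 'I_a -> F) (mu : 'I_b -> F).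
Hypotheses (lam_inj : injective lam) (mu_inj : injective mu).
Hypothesis lamP : forall z : F, leigenvalue (mxop A) z <-> exists i, z = lam i.
Hypothesis muP : forall z : F, leigenvalue (mxop B) z <-> exists j, z = mu j.
Variables (alpha : 'I_a -> seq nat) (beta : 'I_b -> seq nat).
Hypothesis alphaE : forall i, alpha i = weyr_char (mxop A) (lam i).
Hypothesis betaE : forall j, beta j = weyr_char (mxop B) (mu j).

Let kerdimE := kerdim_sylv_weyr lam_inj mu_inj lamP muP alphaE betaE.

Lemma alpha_nonincr i : nonincr (alpha i).
Proof. by rewrite alphaE; apply: weyr_char_nonincr. Qed.

Lemma beta_nonincr j : nonincr (beta j).
Proof. by rewrite betaE; apply: weyr_char_nonincr. Qed.

Lemma alpha_size_gt0 i : (0 < size (alpha i))%N.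
Proof. by rewrite alphaE size_mkseq; have [] := op_indexP (mxop A) (lam i). Qed.

Lemma beta_size_gt0 j : (0 < size (beta j))%N.
Proof. by rewrite betaE size_mkseq; have [] := op_indexP (mxop B) (mu j). Qed.

Lemma alpha_pos i h : (h < size (alpha i))%N -> (0 < nth 0%N (alpha i) h)%N.
Proof. by rewrite alphaE; apply: weyr_char_pos; apply/lamP; exists i. Qed.

Lemma beta_pos j h : (h < size (beta j))%N -> (0 < nth 0%N (beta j) h)%N.
Proof. by rewrite betaE; apply: weyr_char_pos; apply/muP; exists j. Qed.

Lemma kerdim_sylv_formula z k : (0 < k)%N ->
  (kerdim (sylv A B) z k)%:Z =
  \sum_(i < a) \sum_(j < b) (lam i - z == mu j)%:R * ker_formula (alpha i) (beta j) k.
Proof.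
move=> k0; rewrite kerdimE (big_morph Posz PoszD (erefl (0 : int))).
apply: eq_bigr => i _; rewrite (big_morph Posz PoszD (erefl (0 : int))).
apply: eq_bigr => j _; rewrite PoszM -ker_countE //; last exact: beta_nonincr.
by rewrite natz.
Qed.

Lemma sylv_eigenvalue z : leigenvalue (sylv A B) z <-> exists i j, z = lam i - mu j.
Proof.
rewrite eigen_kerdim kerdimE lt0n sum_nat_eq0; split=> [|[i [j ->]]].
  case/forallPn => i; rewrite /= sum_nat_eq0 => /forallPn[j]; rewrite /= muln_eq0 eqb0.
  by rewrite negb_or negbK => /andP[/eqP e _]; exists i, j; rewrite -e subKr.
apply/forallPn; exists i; rewrite /= sum_nat_eq0; apply/forallPn; exists j.
rewrite /= subKr eqxx mul1n -lt0n.
have : (ker_count (alpha i) (beta j) 0 < ker_count (alpha i) (beta j) 1)%N; last first.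
  by rewrite ker_count0.
rewrite ker_count_ltS ?alpha_size_gt0 ?beta_size_gt0 //.
- have := alpha_size_gt0 i; have := beta_size_gt0 j; lia.
- exact: beta_nonincr.
- exact: alpha_pos.
- exact: beta_pos.
Qed.

Lemma sylv_weyr_formula z k : (1 <= k <= size (weyr_char (sylv A B) z))%N ->
  (term (weyr_char (sylv A B) z) k)%:Z =
  \sum_(i < a) \sum_(j < b) (lam i - z == mu j)%:R * weyr_formula (alpha i) (beta j) k.
Proof.
case/andP=> k0 _; rewrite /term nth_weyr_char prednK // -subzn; last first.
  by apply: kerdim_leq; apply: leq_pred.
rewrite !kerdimE !(big_morph Posz PoszD (erefl (0 : int))) -sumrB.
apply: eq_bigr => i _; rewrite !(big_morph Posz PoszD (erefl (0 : int))) -sumrB.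
apply: eq_bigr => j _; rewrite !PoszM -mulrBr -weyr_formulaE ?natz //.
exact: beta_nonincr.
Qed.

(** A sum of nondecreasing sequences is stationary at k exactly when each of its
    terms is. *)
Lemma kerdim_sylv_stationary z k :
  (kerdim (sylv A B) z k == kerdim (sylv A B) z k.+1) =
  (\max_(i < a) \max_(j < b | (lam i - mu j == z)%R) (size (alpha i) + size (beta j) - 1)
     <= k)%N.
Proof.
rewrite !kerdimE !pair_bigA /= eq_sym.
have L (ij : 'I_a * 'I_b) : true ->
  (((lam ij.1 - z == mu ij.2)%R * ker_count (alpha ij.1) (beta ij.2) k)%N <=
   ((lam ij.1 - z == mu ij.2)%R * ker_count (alpha ij.1) (beta ij.2) k.+1)%N
   ?= iff ((lam ij.1 - mu ij.2 == z)%R ==>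
       (size (alpha ij.1) + size (beta ij.2) - 1 <= k)%N))%N.
  move=> _; have -> : (lam ij.1 - z == mu ij.2) = (lam ij.1 - mu ij.2 == z).
    by rewrite !subr_eq addrC.
  case: eqP => _; last by rewrite !mul0n; split.
  rewrite !mul1n; split; first exact: ker_count_leS (@beta_nonincr _) _.
  apply: ker_count_eqS; rewrite ?alpha_size_gt0 ?beta_size_gt0 //.
  - exact: beta_nonincr.
  - exact: alpha_pos.
  - exact: beta_pos.
rewrite eq_sym (leqif_sum L).2.
apply/forallP/bigmax_leqP => [H i _|H [i j]].
  by apply/bigmax_leqP => j e; have /= := H (i, j); rewrite e.
by apply/implyP => _; apply/implyP => /= e; have /bigmax_leqP /(_ j e) := H i isT.
Qed.

Lemma sylv_index z : leigenvalue (sylv A B) z ->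
  op_index (sylv A B) z =
  (\max_(i < a) \max_(j < b | (lam i - mu j == z)%R) (size (alpha i) + size (beta j) - 1))%N.
Proof.
move=> /sylv_eigenvalue [i [j zE]]; rewrite /op_index.
case: ex_minnP => q /andP[q0]; rewrite kerdim_sylv_stationary => le min.
apply/eqP; rewrite eqn_leq le andbT; apply: min.
rewrite kerdim_sylv_stationary leqnn andbT.
apply: leq_trans (leq_bigmax i); apply: leq_trans (leq_bigmax_cond j _); last by rewrite zE.
have := alpha_size_gt0 i; have := beta_size_gt0 j; lia.
Qed.

End SylvesterOperator.

Theorem theorem1p1 (R : realType) (m n : nat) (A : 'M[R[i]]_m) (B : 'M[R[i]]_n)
    (a b : nat) (lam : 'I_a -> R[i]) (mu : 'I_b -> R[i])
    (lam_inj : injective lam) (mu_inj : injective mu)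
    (lamP : forall z : R[i], passmx.leigenvalue (mxop A) z <-> exists i, z = lam i)
    (muP : forall z : R[i], passmx.leigenvalue (mxop B) z <-> exists j, z = mu j)
    (alpha : 'I_a -> seq nat) (beta : 'I_b -> seq nat)
    (alphaE : forall i, alpha i = weyr_char (mxop A) (lam i))
    (betaE : forall j, beta j = weyr_char (mxop B) (mu j)) :
  (* (1) *)
  [/\ forall k : nat, (0 < k)%N ->
        \dim (lker (lpow (sylv A B) k))
        = (\sum_(i < a) \sum_(j < b) (lam i == mu j) *
             \dim (lker (lpow (sylv (nilp_weyr _ (alpha i) : 'M[R[i]]_(weight (alpha i)))
                                    (nilp_weyr _ (beta j) : 'M[R[i]]_(weight (beta j)))) k)))%N
        /\
        (\dim (lker (lpow (sylv A B) k)))%:Z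
        = \sum_(i < a) \sum_(j < b) (lam i == mu j)%:R *
            (\sum_(2 <= r < k.+1)
               \sum_(0 <= l < (minn (size (alpha i)) (size (beta j))).+1)
                 (term (alpha i) (r + l))%:Z *
                 ((term (beta j) (1 + l))%:Z - (term (beta j) (2 + k - r + l))%:Z)
             + \sum_(0 <= l < (minn (size (alpha i)) (size (beta j))).+1)
                 (term (alpha i) (1 + l))%:Z *
                 \sum_(1 <= s < k.+1) (term (beta j) (s + l))%:Z),
  (* (2) *)
      forall k : nat, (0 < k)%N ->
        (forall (i : 'I_a) (j : 'I_b) (r s l : nat), lam i = mu j ->
           (r, s, l) \in triples (size (alpha i)) (size (beta j)) k ->
           (exists x : nat -> R[i],
              chain_sol (size (alpha i)) (size (beta j)) k r s l x) /\
           ((k - r + s + l <= size (beta j))%N ->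
            forall x x' : nat -> R[i],
              chain_sol (size (alpha i)) (size (beta j)) k r s l x ->
              chain_sol (size (alpha i)) (size (beta j)) k r s l x' ->
              forall t, (t <= l)%N -> x t = x' t))
        /\
        (forall x : 'I_a -> 'I_b -> nat -> nat -> nat -> nat -> R[i],
           (forall (i : 'I_a) (j : 'I_b) (r s l : nat), lam i = mu j ->
              (r, s, l) \in triples (size (alpha i)) (size (beta j)) k ->
              chain_sol (size (alpha i)) (size (beta j)) k r s l (x i j r s l)) ->
           basis_of (lker (lpow (sylv (weyr_form lam alpha) (weyr_form mu beta)) k))
                    (ker_basis lam mu alpha beta k x)),
  (* (3) *)
      (forall z : R[i],
         passmx.leigenvalue (sylv A B) z <-> exists i j, z = lam i - mu j) /\
      (forall z : R[i], passmx.leigenvalue (sylv A B) z ->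
         (forall k : nat, (1 <= k <= size (weyr_char (sylv A B) z))%N ->
            (term (weyr_char (sylv A B) z) k)%:Z
            = \sum_(i < a) \sum_(j < b) (lam i - z == mu j)%:R *
                \sum_(0 <= l < (minn (size (alpha i)) (size (beta j))).+1)
                  ((term (alpha i) (1 + l))%:Z * (term (beta j) (k + l))%:Z
                   + \sum_(2 <= r < k.+1)
                       (term (alpha i) (r + l))%:Z *
                       ((term (beta j) (1 + k - r + l))%:Z
                        - (term (beta j) (2 + k - r + l))%:Z)))
         /\
         op_index (sylv A B) z
         = (\max_(i < a) \max_(j < b | (lam i - mu j == z)%R)
              (size (alpha i) + size (beta j) - 1))%N)
  (* (4) *)
    & forall (C : 'M[R[i]]_m) (D : 'M[R[i]]_n),
        op_similar (sylv A B) (sylv C D) <->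
        (forall z : R[i], passmx.leigenvalue (sylv A B) z ->
           forall k : nat, (1 <= k <= m * n)%N ->
             \dim (lker (lpow (sylv (A - z%:M) B) k))
             = \dim (lker (lpow (sylv (C - z%:M) D) k)))].
Proof.
have alP := alpha_nonincr alphaE; have beP := beta_nonincr betaE.
have al0 := alpha_size_gt0 alphaE; have be0 := beta_size_gt0 betaE.
have kdE := kerdim_sylv_weyr lam_inj mu_inj lamP muP alphaE betaE.
split.
- move=> k k0; rewrite kerdim_sylv0; split.
    rewrite kdE; apply: eq_bigr => i _; apply: eq_bigr => j _.
    by rewrite subr0 dim_ker_nilp.
  rewrite (kerdim_sylv_formula lam_inj mu_inj lamP muP alphaE betaE) //.
  by apply: eq_bigr => i _; apply: eq_bigr => j _; rewrite subr0.
- move=> k k0; split=> [i j r s l _ T|x xP].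
    split; first by eexists; apply: chain_sol_window.
    by move=> kq x x'; apply: (chain_sol_unique (al0 i) (be0 j) k0 T kq).
  rewrite !weyr_form_coords ker_basis_labels.
  apply: (label_basis (weyr_pos_coords alpha) (weyr_pos_coords beta)) => // i j r s l eq0 T.
  by apply: (chain_sol_poly (al0 i) (be0 j) k0 T); apply: xP.
- split; first exact: (sylv_eigenvalue lam_inj mu_inj lamP muP alphaE betaE).
  move=> z ez; split; last exact: (sylv_index lam_inj mu_inj lamP muP alphaE betaE ez).
  exact: (sylv_weyr_formula lam_inj mu_inj lamP muP alphaE betaE).
- by move=> C D; apply: sylv_similarP.
Qed.
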